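(* Let $(\lambda_n)_{n\in\mathbb{N}_0}$ be real numbers with $\limsup_{n\to\infty}|\lambda_n|/n\le\beta$ for some $\beta>0$. Let $\gamma>0$, $f\in C^\infty[x_0,x_0+\gamma]$, and suppose there are constants $C>0$, $\sigma>0$ with $|D^{(2n)}f(t)|\le C(2n)!\sigma^{2n}$ for all $t\in[x_0,x_0+\gamma]$, $n\in\mathbb{N}_0$. Then the series $$F(z)=\sum_{n=0}^\infty D^{(n)}f(x_0)\,\Phi_{\Lambda_n}(z-x_0)$$ converges absolutely and uniformly on compact subsets of the disc in $\mathbb{C}$ with center $x_0$ and radius $\frac1\beta\ln(1+\frac\beta\sigma)$, its sum $F$ is analytic there, and there is $\delta>0$ such that $F(x)=f(x)$ for all $x\in[x_0,x_0+\delta]$ (i.e. $F$ is an analytic extension of $f$ near $x_0$).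
   Context: For $\lambda_0,\dots,\lambda_n\in\mathbb{C}$ the fundamental function is the entire function $\Phi_{(\lambda_0,\dots,\lambda_n)}(z)=\frac{1}{2\pi i}\int_{|w|=R}\frac{e^{zw}}{(w-\lambda_0)\cdots(w-\lambda_n)}\,dw$, where $R>\max_j|\lambda_j|$ and the circle is positively oriented. For a sequence $(\lambda_n)$, $\Lambda_n=(\lambda_0,\dots,\lambda_n)$, $\Phi_{\Lambda_n}=\Phi_{(\lambda_0,\dots,\lambda_n)}$, and $D^{(n)}f=(\frac{d}{dt}-\lambda_0)\cdots(\frac{d}{dt}-\lambda_{n-1})f$ with $D^{(0)}f=f$. *)

(* Defs.v *)
From Stdlib Require Import Reals Lra ClassicalEpsilon.
Open Scope R_scope.

Definition Cplx : Type := (R * R)%type.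
Definition RtoC (x : R) : Cplx := (x, 0).
Definition Cadd (z w : Cplx) : Cplx := (fst z + fst w, snd z + snd w).
Definition Copp (z : Cplx) : Cplx := (- fst z, - snd z).
Definition Csub (z w : Cplx) : Cplx := Cadd z (Copp w).
Definition Cmul (z w : Cplx) : Cplx :=
  (fst z * fst w - snd z * snd w, fst z * snd w + snd z * fst w).
Definition Cinv (z : Cplx) : Cplx :=
  let d := fst z * fst z + snd z * snd z in (fst z / d, - snd z / d).
Definition Cscal (a : R) (z : Cplx) : Cplx := (a * fst z, a * snd z).
Definition Cnorm (z : Cplx) : R := sqrt (fst z * fst z + snd z * snd z).
Definition Cexp (z : Cplx) : Cplx := (exp (fst z) * cos (snd z), exp (fst z) * sin (snd z)).
Definition C0 : Cplx := (0, 0).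

Definition RInt (f : R -> R) (a b : R) : R :=
  epsilon (inhabits 0) (fun v => exists pr : Riemann_integrable f a b, RiemannInt pr = v).

Fixpoint Cprod_lin (lam : nat -> R) (n : nat) (w : Cplx) : Cplx :=
  match n with
  | O => Csub w (RtoC (lam O))
  | S m => Cmul (Cprod_lin lam m w) (Csub w (RtoC (lam (S m))))
  end.

Fixpoint maxabs (lam : nat -> R) (n : nat) : R :=
  match n with
  | O => Rabs (lam O)
  | S m => Rmax (maxabs lam m) (Rabs (lam (S m)))
  end.

(** Fundamental function Phi_{(lam 0,...,lam n)}(z)
    = 1/(2 pi i) \oint_{|w|=Rad} e^{zw} / prod_j (w - lam j) dw,
    with the circle parametrized as w = Rad e^{i theta}, dw = i w dtheta,
    so that Phi = 1/(2 pi) \int_0^{2 pi} w e^{zw} / prod_j (w - lam j) dtheta.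
    Radius Rad := 1 + max_j |lam j| > max_j |lam j|. *)
Definition Phi_integrand (lam : nat -> R) (n : nat) (z : Cplx) (theta : R) : Cplx :=
  let Rad := 1 + maxabs lam n in
  let w : Cplx := (Rad * cos theta, Rad * sin theta) in
  Cmul (Cmul w (Cexp (Cmul z w))) (Cinv (Cprod_lin lam n w)).

Definition Phi (lam : nat -> R) (n : nat) (z : Cplx) : Cplx :=
  Cscal (/ (2 * PI))
    (RInt (fun t => fst (Phi_integrand lam n z t)) 0 (2 * PI),
     RInt (fun t => snd (Phi_integrand lam n z t)) 0 (2 * PI)).

Definition deriv_within (a b : R) (g : R -> R) (x l : R) : Prop :=
  forall eps, 0 < eps -> exists d, 0 < d /\
    forall y, a <= y <= b -> 0 < Rabs (y - x) < d ->
      Rabs ((g y - g x) / (y - x) - l) < eps.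

Definition smooth_seq_on (a b : R) (fd : nat -> R -> R) : Prop :=
  forall k x, a <= x <= b -> deriv_within a b (fd k) x (fd (S k) x).

(** Derivative sequence of D^{(n)} f = (d/dt - lam 0) ... (d/dt - lam (n-1)) f :
    Dseq lam n fd k is the k-th derivative of D^{(n)} f. *)
Fixpoint Dseq (lam : nat -> R) (n : nat) (fd : nat -> R -> R) : nat -> R -> R :=
  match n with
  | O => fd
  | S m => fun k t => Dseq lam m fd (S k) t - lam m * Dseq lam m fd k t
  end.

Definition Dn (lam : nat -> R) (n : nat) (fd : nat -> R -> R) (t : R) : R :=
  Dseq lam n fd O t.

Definition term (lam : nat -> R) (fd : nat -> R -> R) (x0 : R) (n : nat) (z : Cplx) : Cplx :=
  Cscal (Dn lam n fd x0) (Phi lam n (Csub z (RtoC x0))).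

Fixpoint psum (lam : nat -> R) (fd : nat -> R -> R) (x0 : R) (N : nat) (z : Cplx) : Cplx :=
  match N with
  | O => C0
  | S m => Cadd (psum lam fd x0 m z) (term lam fd x0 m z)
  end.

Fixpoint abs_block (lam : nat -> R) (fd : nat -> R -> R) (x0 : R) (N M : nat) (z : Cplx) : R :=
  match M with
  | O => Cnorm (term lam fd x0 N z)
  | S m => abs_block lam fd x0 N m z + Cnorm (term lam fd x0 (N + S m) z)
  end.

Definition C_differentiable (F : Cplx -> Cplx) (z : Cplx) : Prop :=
  exists l : Cplx, forall eps, 0 < eps -> exists d, 0 < d /\
    forall h : Cplx, Cnorm h < d ->
      Cnorm (Csub (Csub (F (Cadd z h)) (F z)) (Cmul l h)) <= eps * Cnorm h.

(* Main.v *)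
(** Since [Phi_n' = lam_n Phi_n + Phi_(n-1)] with [Phi_n(0) = 0] for [n > 0],
    comparison with the exponents [A, A + b, ..., A + n b], for some [b > beta] close to [beta], gives
    [|Phi_n(z)| <= e^(A r) ((e^(b r) - 1) / b)^n / n!] for [|z| <= r].  A Landau-type inequality
    on intervals of length [gamma / (n+1)], where the coefficients [lam_(2n)], [lam_(2n+1)] act
    as bounded ones, extends the estimate on [D^(2n) f(x0)] to odd orders without changing
    [sigma], so the series is dominated by a geometric one of ratio
    [sigma (e^(b r) - 1) / b < 1].  Finally
    [t |-> sum_(n < N) D^(n) f(t) Phi_n(x - t)] equals [f(x)] at [t = x] and has the telescoped
    derivative [D^(N) f(t) Phi_(N-1)(x - t)], which tends to 0 uniformly along even [N]. *)

From Stdlib Require Import Reals Factorial Lra Lia ClassicalEpsilon.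
From Coquelicot Require Import Coquelicot.
Require Import Defs.
Open Scope R_scope.

(** * Curves and functions of a complex variable *)

(** [Phi] is a contour integral whose radius depends on [n], so even the recursion for [Phi_n']
    compares integrals over different circles. No general Cauchy theorem is used: [fund] keeps the
    radius free, the basic integrals vanish because they have explicit periodic primitives, and
    independence of the radius comes from uniqueness for the recursion. Increments of complex-valued
    functions are estimated by one mean value inequality for curves. The limsup gives
    [|lam_n| <= A + b n] only for [b > beta]; the strict inequality [r < rho] leaves room for such a
    [b]. The interval length [gamma / (n+1)] balances factorials: dividing by it costs a factor of
    order [n], which turns [(2n)!] into at most a multiple of [(2n+1)!], and multiplying by it turns
    [(2n+2)!] into a multiple of [(2n+1)!]. Odd orders are thereby bounded at [x0] alone, which
    suffices for the coefficients of the series; the remainder needs a bound at every base point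
    [t], hence the restriction to even [N]. *)

Lemma Cnorm_Cmod (z : C) : Cnorm z = Cmod z.
Proof. unfold Cnorm, Cmod. f_equal. ring. Qed.

Lemma Cmod_le_fst_snd (z : C) (M : R) :
  Rabs (fst z) <= M -> Rabs (snd z) <= M -> Cmod z <= 2 * M.
Proof.
  intros H1 H2. eapply Rle_trans; [apply Cmod_2Rmax|].
  assert (0 <= M) by (eapply Rle_trans; [apply Rabs_pos|exact H1]).
  assert (sqrt 2 <= 2).
  { rewrite <- (sqrt_Rsqr 2) at 2 by lra. apply sqrt_le_1_alt. unfold Rsqr; lra. }
  apply Rmult_le_compat; auto using sqrt_pos.
  - eapply Rle_trans; [apply Rabs_pos|apply Rmax_l].
  - apply Rmax_lub; assumption.
Qed.

Lemma fst_le_Cmod (z : C) : Rabs (fst z) <= Cmod z.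
Proof. eapply Rle_trans; [apply Rmax_l|apply Rmax_Cmod]. Qed.

Lemma snd_le_Cmod (z : C) : Rabs (snd z) <= Cmod z.
Proof. eapply Rle_trans; [apply Rmax_r|apply Rmax_Cmod]. Qed.

Lemma Cmod_triangle_rev (x y : C) : Cmod x - Cmod y <= Cmod (x - y).
Proof.
  replace x with ((x - y) + y)%C at 1 by ring.
  pose proof (Cmod_triangle (x - y) y). lra.
Qed.

Lemma Cmod_sub_comm (x y : C) : Cmod (x - y) = Cmod (y - x).
Proof. rewrite <- Cmod_opp. f_equal. ring. Qed.

Lemma Cexp_add (z w : C) : Cexp (z + w)%C = (Cexp z * Cexp w)%C.
Proof.
  unfold Cexp, Cplus, Cmult; simpl. rewrite exp_plus, cos_plus, sin_plus.
  f_equal; ring.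
Qed.

Lemma Cexp_0 : Cexp (Complex.RtoC 0) = Complex.RtoC 1.
Proof. unfold Cexp, Complex.RtoC; simpl. rewrite exp_0, cos_0, sin_0. f_equal; ring. Qed.

Lemma Cmod_Cexp (z : C) : Cmod (Cexp z) = exp (fst z).
Proof.
  unfold Cmod, Cexp; simpl.
  replace (_ + _) with (Rsqr (exp (fst z)) * (Rsqr (sin (snd z)) + Rsqr (cos (snd z))))
    by (unfold Rsqr; ring).
  rewrite sin2_cos2, Rmult_1_r. apply sqrt_Rsqr, Rlt_le, exp_pos.
Qed.

Lemma exp_le_mono (x y : R) : x <= y -> exp x <= exp y.
Proof. intros [H| ->]; [left; now apply exp_increasing|apply Rle_refl]. Qed.

Lemma Cmod_Cexp_le (z : C) : Cmod (Cexp z) <= exp (Cmod z).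
Proof.
  rewrite Cmod_Cexp. apply exp_le_mono.
  eapply Rle_trans; [apply Rle_abs|apply fst_le_Cmod].
Qed.

(** Coordinatewise, so that real derivative rules and the real fundamental theorem apply to each
    component. *)
Definition curve_deriv (psi : R -> C) (s : R) (l : C) : Prop :=
  is_derive (fun t => fst (psi t)) s (fst l) /\ is_derive (fun t => snd (psi t)) s (snd l).

Lemma curve_deriv_const (c : C) (s : R) : curve_deriv (fun _ => c) s (Complex.RtoC 0).
Proof. split; simpl; apply @is_derive_const. Qed.

Lemma curve_deriv_affine (a b : C) (s : R) : curve_deriv (fun t => (a + t * b)%C) s b.
Proof. split; simpl; auto_derive; trivial; ring. Qed.

Lemma curve_deriv_val (psi : R -> C) (s : R) (l l' : C) :
  curve_deriv psi s l -> l = l' -> curve_deriv psi s l'.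
Proof. now intros H <-. Qed.

Lemma curve_deriv_ext (psi phi : R -> C) (s : R) (l : C) :
  (forall t, psi t = phi t) -> curve_deriv psi s l -> curve_deriv phi s l.
Proof.
  intros E [H1 H2]; split;
    [eapply is_derive_ext; [|exact H1]|eapply is_derive_ext; [|exact H2]];
    intros; simpl; now rewrite E.
Qed.

Lemma curve_deriv_add (f g : R -> C) (s : R) (l m : C) :
  curve_deriv f s l -> curve_deriv g s m ->
  curve_deriv (fun t => (f t + g t)%C) s (l + m)%C.
Proof.
  intros [H1 H2] [H3 H4]; split; simpl.
  - exact (is_derive_plus (fun t => fst (f t)) _ s _ _ H1 H3).
  - exact (is_derive_plus (fun t => snd (f t)) _ s _ _ H2 H4).
Qed.

Lemma curve_deriv_sub (f g : R -> C) (s : R) (l m : C) :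
  curve_deriv f s l -> curve_deriv g s m ->
  curve_deriv (fun t => (f t - g t)%C) s (l - m)%C.
Proof.
  intros [H1 H2] [H3 H4]; split; simpl.
  - exact (is_derive_minus (fun t => fst (f t)) _ s _ _ H1 H3).
  - exact (is_derive_minus (fun t => snd (f t)) _ s _ _ H2 H4).
Qed.

Lemma curve_deriv_mul (f g : R -> C) (s : R) (l m : C) :
  curve_deriv f s l -> curve_deriv g s m ->
  curve_deriv (fun t => (f t * g t)%C) s (l * g s + f s * m)%C.
Proof.
  intros [H1 H2] [H3 H4].
  assert (P : forall p q p' q', is_derive p s p' -> is_derive q s q' ->
     is_derive (fun t => p t * q t) s (p' * q s + p s * q')).
  { intros p q p' q' Hp Hq. exact (is_derive_mult p q s p' q' Hp Hq Rmult_comm). }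
  split; simpl.
  - replace (_ + _) with ((fst l * fst (g s) + fst (f s) * fst m)
        - (snd l * snd (g s) + snd (f s) * snd m)) by (simpl; ring).
    exact (is_derive_minus _ _ s _ _ (P _ _ _ _ H1 H3) (P _ _ _ _ H2 H4)).
  - replace (_ + _) with ((fst l * snd (g s) + fst (f s) * snd m)
        + (snd l * fst (g s) + snd (f s) * fst m)) by (simpl; ring).
    exact (is_derive_plus _ _ s _ _ (P _ _ _ _ H1 H4) (P _ _ _ _ H2 H3)).
Qed.

Lemma curve_deriv_exp (f : R -> C) (s : R) (l : C) :
  curve_deriv f s l -> curve_deriv (fun t => Cexp (f t)) s (Cexp (f s) * l)%C.
Proof.
  intros [H1 H2].
  assert (P : forall (p q : R -> R) (p' q' : R), is_derive p s p' -> is_derive q s q' ->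
    is_derive (fun t => exp (p t) * cos (q t)) s
      (exp (p s) * cos (q s) * p' - exp (p s) * sin (q s) * q') /\
    is_derive (fun t => exp (p t) * sin (q t)) s
      (exp (p s) * cos (q s) * q' + exp (p s) * sin (q s) * p')).
  { intros p q p' q' Hp Hq.
    assert (D1 : Derive (fun x => p x) s = p') by now apply is_derive_unique.
    assert (D2 : Derive (fun x => q x) s = q') by now apply is_derive_unique.
    assert (E1 : ex_derive p s) by (eexists; eauto).
    assert (E2 : ex_derive q s) by (eexists; eauto).
    split; auto_derive; auto; rewrite D1, D2; ring. }
  exact (P _ _ _ _ H1 H2).
Qed.

(* Project [psi b - psi a] on its own direction to reduce to the real mean value theorem. *)
Lemma curve_mean_value (psi l : R -> C) (g g' : R -> R) (a b : R) : a <= b ->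
  (forall s, a <= s <= b -> curve_deriv psi s (l s)) ->
  (forall s, a <= s <= b -> is_derive g s (g' s)) ->
  (forall s, a <= s <= b -> Cmod (l s) <= g' s) ->
  Cmod (psi b - psi a)%C <= g b - g a.
Proof.
  intros Hab Hpsi Hg Hle.
  set (d := (psi b - psi a)%C).
  assert (Main : forall c1 c2, c1 * c1 + c2 * c2 <= 1 ->
    c1 * fst d + c2 * snd d <= g b - g a).
  { intros c1 c2 Hc.
    assert (D : forall s, a <= s <= b ->
      is_derive (fun s => c1 * fst (psi s) + c2 * snd (psi s) - g s) s
        (c1 * fst (l s) + c2 * snd (l s) - g' s)).
    { intros s Hs. destruct (Hpsi s Hs) as [H1 H2]. specialize (Hg s Hs).
      exact (is_derive_minus _ _ _ _ _ (is_derive_plus _ _ _ _ _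
        (is_derive_scal _ _ c1 _ H1) (is_derive_scal _ _ c2 _ H2)) Hg). }
    destruct (MVT_gen _ a b _ (fun s Hs => D s ltac:(rewrite Rmin_left, Rmax_right in Hs; lra)))
      as [xi [Hxi E]].
    - intros s Hs. rewrite Rmin_left, Rmax_right in Hs by lra.
      apply derivable_continuous_pt. eexists. apply is_derive_Reals, (D s Hs).
    - rewrite Rmin_left, Rmax_right in Hxi by lra.
      specialize (Hle xi Hxi).
      assert (c1 * fst (l xi) + c2 * snd (l xi) <= Cmod (l xi)).
      { apply Rle_trans with (Rabs (c1 * fst (l xi) + c2 * snd (l xi))); [apply Rle_abs|].
        rewrite <- sqrt_Rsqr_abs. unfold Cmod. apply sqrt_le_1_alt. unfold Rsqr.
        set (p := fst (l xi)) in *. set (q := snd (l xi)) in *.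
        (* Cauchy-Schwarz by Lagrange's identity: the defect is the square of [c1 q - c2 p] plus the
           slack left by [c1^2 + c2^2 <= 1]. *)
        assert (0 <= (1 - (c1*c1+c2*c2)) * (p*p+q*q)) by (apply Rmult_le_pos; nra).
        pose proof (Rle_0_sqr (c1 * q - c2 * p)). unfold Rsqr in *. nra. }
      assert ((c1 * fst (l xi) + c2 * snd (l xi) - g' xi) * (b - a) <= 0) by nra.
      unfold d; simpl. lra. }
  (* The direction of [d] exists only for [d] nonzero; otherwise [c1 = c2 = 0] already gives the
     claim. *)
  destruct (Req_dec (Cmod d) 0) as [E|E].
  - rewrite E. specialize (Main 0 0). lra.
  - assert (Sq : Cmod d * Cmod d = fst d * fst d + snd d * snd d).
    { unfold Cmod. rewrite sqrt_def; [ring|nra]. }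
    assert (Hpos : 0 < Cmod d) by (pose proof (Cmod_ge_0 d); lra).
    specialize (Main (fst d / Cmod d) (snd d / Cmod d)).
    replace (fst d / Cmod d * fst d + snd d / Cmod d * snd d) with (Cmod d) in Main.
    2:{ apply Rmult_eq_reg_r with (Cmod d); auto. rewrite Sq. field; auto. }
    apply Main. right.
    apply Rmult_eq_reg_r with (Cmod d * Cmod d); [|nra].
    rewrite Rmult_1_l. rewrite Sq at 2. field; auto.
Qed.

(** * Complex differentiability and its restriction to segments *)

Definition complex_deriv (U : C -> C) (z l : C) : Prop :=
  forall eps, 0 < eps -> exists d, 0 < d /\
    forall h : C, Cmod h < d -> Cmod (U (z + h) - U z - l * h)%C <= eps * Cmod h.

Lemma complex_deriv_ext (U V : C -> C) (z l : C) :
  (forall z, U z = V z) -> complex_deriv U z l -> complex_deriv V z l.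
Proof.
  intros E H eps He. destruct (H eps He) as [d [Hd H']]. exists d; split; auto.
  intros h Hh. rewrite <- !E. auto.
Qed.

(** The single form [U + c V] serves as sum ([c = 1]), difference ([c = -1]) and scalar multiple
    ([U = 0]); the linearity lemmas for means and sums below have the same shape. *)
Lemma complex_deriv_lin (U V : C -> C) (z l m c : C) :
  complex_deriv U z l -> complex_deriv V z m ->
  complex_deriv (fun z => U z + c * V z)%C z (l + c * m)%C.
Proof.
  intros HU HV eps He.
  destruct (HU (eps/2)) as [d1 [Hd1 H1]]; [lra|].
  assert (Hc := Cmod_ge_0 c).
  assert (He' : 0 < eps / 2 / (1 + Cmod c)) by (apply Rdiv_lt_0_compat; lra).
  destruct (HV _ He') as [d2 [Hd2 H2]].
  exists (Rmin d1 d2). split; [now apply Rmin_pos|]. intros h Hh.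
  specialize (H1 h (Rlt_le_trans _ _ _ Hh (Rmin_l _ _))).
  specialize (H2 h (Rlt_le_trans _ _ _ Hh (Rmin_r _ _))).
  replace (_ - _ - _)%C with ((U (z + h) - U z - l * h) + c * (V (z + h) - V z - m * h))%C
    by ring.
  eapply Rle_trans; [apply Cmod_triangle|]. rewrite Cmod_mult.
  assert (Cmod c * Cmod (V (z + h) - V z - m * h)%C <= eps / 2 * Cmod h).
  { apply Rle_trans with (Cmod c * (eps / 2 / (1 + Cmod c) * Cmod h)).
    - now apply Rmult_le_compat_l.
    - replace (Cmod c * (eps / 2 / (1 + Cmod c) * Cmod h)) with
        ((eps / 2 * Cmod h) * (Cmod c / (1 + Cmod c))) by (field; lra).
      rewrite <- (Rmult_1_r (eps / 2 * Cmod h)) at 2.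
      apply Rmult_le_compat_l; [pose proof (Cmod_ge_0 h); nra|].
      apply Rle_div_l; lra. }
  lra.
Qed.

(** Chain rule along an affine path; it turns complex differentiability into a statement about
    curves, where [curve_mean_value] applies. *)
Lemma complex_deriv_line (U : C -> C) (a b l : C) (s : R) :
  complex_deriv U (a + s * b)%C l -> curve_deriv (fun t => U (a + t * b)%C) s (l * b)%C.
Proof.
  intros H.
  (* Kept multiplied out, so that one complex estimate yields the difference quotients of both
     coordinates. *)
  assert (K : forall eps, 0 < eps -> exists d, 0 < d /\ forall t, Rabs (t - s) < d ->
     Cmod (U (a + t * b) - U (a + s * b) - (t - s)%R * (l * b))%C <= eps * Rabs (t - s)).
  { intros eps He. pose proof (Cmod_ge_0 b).
    assert (He' : 0 < eps / (1 + Cmod b)) by (apply Rdiv_lt_0_compat; lra).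
    destruct (H _ He') as [d [Hd H']].
    exists (d / (1 + Cmod b)). split; [apply Rdiv_lt_0_compat; lra|].
    intros t Ht. apply Rlt_div_r in Ht; [|lra].
    assert (Hh : Cmod ((t - s)%R * b)%C = Rabs (t - s) * Cmod b)
      by (rewrite Cmod_mult, Cmod_R; reflexivity).
    pose proof (Rabs_pos (t - s)).
    specialize (H' ((t - s)%R * b)%C). rewrite Hh in H'.
    replace (a + s * b + (t - s)%R * b)%C with (a + t * b)%C in H'
      by (rewrite RtoC_minus; ring).
    replace (l * ((t - s)%R * b))%C with ((t - s)%R * (l * b))%C in H' by ring.
    eapply Rle_trans; [apply H'; nra|].
    replace (eps / (1 + Cmod b) * (Rabs (t - s) * Cmod b)) with
      ((eps * Rabs (t - s)) * (Cmod b / (1 + Cmod b))) by (field; lra).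
    rewrite <- (Rmult_1_r (eps * Rabs (t - s))) at 2.
    apply Rmult_le_compat_l; [nra|]. apply Rle_div_l; lra. }
  split; apply is_derive_Reals; intros eps He;
    destruct (K (eps / 2)) as [d [Hd K']]; try lra;
    exists (mkposreal d Hd); intros h Hh Hhd; simpl in Hhd;
    specialize (K' (s + h)); replace (s + h - s) with h in K' by ring;
    specialize (K' Hhd).
  - assert (Q := Rle_trans _ _ _ (fst_le_Cmod _) K').
    match goal with |- Rabs ?e < _ => replace e with
      (fst (U (a + (s + h)%R * b) - U (a + s * b) - h * (l * b))%C / h) end.
    + rewrite Rabs_div by auto. pose proof (Rabs_pos_lt h Hh).
      apply Rle_lt_trans with (eps / 2); [|lra].
      apply Rle_div_l; auto.
    + unfold Cminus, Cplus, Copp, Complex.Copp, Cmult; simpl. field. auto.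
  - assert (Q := Rle_trans _ _ _ (snd_le_Cmod _) K').
    match goal with |- Rabs ?e < _ => replace e with
      (snd (U (a + (s + h)%R * b) - U (a + s * b) - h * (l * b))%C / h) end.
    + rewrite Rabs_div by auto. pose proof (Rabs_pos_lt h Hh).
      apply Rle_lt_trans with (eps / 2); [|lra].
      apply Rle_div_l; auto.
    + unfold Cminus, Cplus, Copp, Complex.Copp, Cmult; simpl. field. auto.
Qed.

Lemma Cmod_increment_le (U U' : C -> C) (z h : C) (M : R) :
  (forall t, 0 <= t <= 1 -> complex_deriv U (z + t * h)%C (U' (z + t * h)%C)) ->
  (forall t, 0 <= t <= 1 -> Cmod (U' (z + t * h)%C) <= M) ->
  Cmod (U (z + h) - U z)%C <= M * Cmod h.
Proof.
  intros HU HM.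
  replace (U (z + h)%C) with (U (z + 1 * h)%C) by (f_equal; ring).
  replace (U z) with (U (z + 0 * h)%C) by (f_equal; ring).
  replace (M * Cmod h) with (M * Cmod h * 1 - M * Cmod h * 0) by ring.
  apply (curve_mean_value (fun t => U (z + t * h)%C) (fun t => U' (z + t * h) * h)%C
    (fun t => M * Cmod h * t) (fun _ => M * Cmod h)); [lra| | |].
  - intros s Hs. apply complex_deriv_line; auto.
  - intros s _. auto_derive; auto; ring.
  - intros s Hs. rewrite Cmod_mult. apply Rmult_le_compat_r; auto using Cmod_ge_0.
Qed.

Lemma Cmod_Cexp_sub_1_le (u : C) (s : R) : Cmod u <= 1 -> 0 <= s <= 1 ->
  Cmod (Cexp (s * u) - 1)%C <= exp 1 * Cmod u * s.
Proof.
  intros Hu Hs.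
  pose proof (curve_mean_value (fun t => Cexp (0 + t * u)%C) (fun t => Cexp (0 + t * u) * u)%C
    (fun t => exp 1 * Cmod u * t) (fun _ => exp 1 * Cmod u) 0 s) as P.
  cbv beta in P.
  assert (E0 : (0 + 0 * u)%C = Complex.RtoC 0) by ring. rewrite E0, Cexp_0 in P.
  rewrite Cplus_0_l in P.
  eapply Rle_trans; [apply P|].
  - lra.
  - intros t _. apply curve_deriv_exp, curve_deriv_affine.
  - intros t _. auto_derive; auto; ring.
  - intros t Ht. rewrite Cmod_mult. apply Rmult_le_compat_r; [apply Cmod_ge_0|].
    eapply Rle_trans; [apply Cmod_Cexp_le|]. apply exp_le_mono.
    rewrite Cplus_0_l, Cmod_mult, Cmod_R, Rabs_pos_eq by lra.
    pose proof (Cmod_ge_0 u). nra.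
  - right. ring.
Qed.

(** The remainder is of order [|u|^2]: the path [t |-> Cexp(t u) - t u] has derivative
    [(Cexp(t u) - 1) u], which the previous lemma bounds by [e |u|^2]. Hence the threshold
    [eps / e], with [|u| < 1] for the previous lemma. *)
Lemma Cexp_deriv_0 (eps : R) : 0 < eps -> exists d, 0 < d /\
  forall u : C, Cmod u < d -> Cmod (Cexp u - 1 - u)%C <= eps * Cmod u.
Proof.
  intros He. pose proof (exp_pos 1) as H1.
  exists (Rmin 1 (eps / exp 1)). split; [apply Rmin_pos; [lra|now apply Rdiv_lt_0_compat]|].
  intros u Hu. assert (Hu1 := Rlt_le_trans _ _ _ Hu (Rmin_l _ _)).
  assert (Hu2 := Rlt_le_trans _ _ _ Hu (Rmin_r _ _)).
  apply Rlt_div_r in Hu2; auto. pose proof (Cmod_ge_0 u).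
  pose proof (curve_mean_value (fun t => Cexp (0 + t * u) - (0 + t * u))%C
    (fun t => Cexp (0 + t * u) * u - u)%C
    (fun t => exp 1 * Cmod u * Cmod u * t) (fun _ => exp 1 * Cmod u * Cmod u) 0 1) as P.
  replace (Cexp u - 1 - u)%C with (Cexp (0 + 1 * u) - (0 + 1 * u) - (Cexp (0 + 0 * u) - (0 + 0 * u)))%C.
  2:{ replace (0 + 1 * u)%C with u by ring. replace (0 + 0 * u)%C with (Complex.RtoC 0) by ring.
      rewrite Cexp_0. change (Defs.RtoC 1) with (Complex.RtoC 1).
      change (Defs.RtoC 0) with (Complex.RtoC 0). ring. }
  eapply Rle_trans; [apply P|].
  - lra.
  - intros t _. apply curve_deriv_sub; [apply curve_deriv_exp|]; apply curve_deriv_affine.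
  - intros t _. auto_derive; auto; ring.
  - intros t Ht. replace (Cexp (0 + t * u) * u - u)%C with ((Cexp (t * u) - 1) * u)%C
      by (rewrite Cplus_0_l; ring).
    rewrite Cmod_mult. apply Rmult_le_compat_r; auto.
    eapply Rle_trans; [apply Cmod_Cexp_sub_1_le; lra|].
    rewrite <- (Rmult_1_r (exp 1 * Cmod u)) at 2. apply Rmult_le_compat_l; nra.
  - nra.
Qed.

(** * Means over a circle *)

Definition curve_cont (g : R -> C) : Prop :=
  forall s : R, continuous (fun t : R => fst (g t)) s /\ continuous (fun t : R => snd (g t)) s.

Lemma curve_cont_deriv (g l : R -> C) :
  (forall s, curve_deriv g s (l s)) -> curve_cont g.
Proof.
  intros H s; destruct (H s) as [H1 H2]; split;
    [apply (ex_derive_continuous (fun t => fst (g t)))|apply (ex_derive_continuous (fun t => snd (g t)))];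
    eexists; eauto.
Qed.

Lemma curve_cont_ext (f g : R -> C) :
  (forall t, f t = g t) -> curve_cont f -> curve_cont g.
Proof.
  intros E H s; destruct (H s) as [H1 H2]; split;
    [apply continuous_ext with (2 := H1)|apply continuous_ext with (2 := H2)];
    intros x; cbv beta; now rewrite (E x).
Qed.

Lemma curve_cont_const (c : C) : curve_cont (fun _ => c).
Proof. apply (curve_cont_deriv _ (fun _ => Complex.RtoC 0)). intros; apply curve_deriv_const. Qed.

Lemma curve_cont_mul (f g : R -> C) :
  curve_cont f -> curve_cont g -> curve_cont (fun t => f t * g t)%C.
Proof.
  intros Hf Hg s; destruct (Hf s) as [F1 F2], (Hg s) as [G1 G2].
  assert (P : forall p q : R -> R, continuous p s -> continuous q s ->
    continuous (fun t => p t * q t) s) by (intros; now apply (continuous_mult (K:=R_AbsRing))).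
  split; simpl.
  - apply (continuous_minus (V:=R_NormedModule)); now apply P.
  - apply (continuous_plus (V:=R_NormedModule)); now apply P.
Qed.

Lemma curve_cont_add (f g : R -> C) :
  curve_cont f -> curve_cont g -> curve_cont (fun t => f t + g t)%C.
Proof.
  intros Hf Hg s; destruct (Hf s) as [F1 F2], (Hg s) as [G1 G2].
  split; simpl; now apply (continuous_plus (V:=R_NormedModule)).
Qed.

Lemma curve_cont_inv (f : R -> C) :
  curve_cont f -> (forall t, f t <> Complex.RtoC 0) -> curve_cont (fun t => / f t)%C.
Proof.
  intros Hf Hn s; destruct (Hf s) as [F1 F2].
  assert (P : forall p q : R -> R, continuous p s -> continuous q s ->
    continuous (fun t => p t * q t) s) by (intros; now apply (continuous_mult (K:=R_AbsRing))).
  assert (Hd : fst (f s) * fst (f s) + snd (f s) * snd (f s) <> 0).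
  { intros E. apply (Hn s). destruct (f s) as [a b]; simpl in *.
    unfold Complex.RtoC; f_equal; nra. }
  assert (D : continuous (fun t => / (fst (f t) ^ 2 + snd (f t) ^ 2)) s).
  { apply continuous_comp with (g := Rinv).
    - apply (continuous_plus (V:=R_NormedModule)); simpl;
      (apply P; [assumption|]); (apply P; [assumption|]); apply continuous_const.
    - apply (ex_derive_continuous Rinv). auto_derive. simpl. lra. }
  split; simpl; apply P; auto.
  now apply (continuous_opp (V:=R_NormedModule)).
Qed.

Lemma curve_cont_pow (f : R -> C) (p : nat) :
  curve_cont f -> curve_cont (fun t => f t ^ p)%C.
Proof.
  intros Hf; induction p; simpl.
  - apply curve_cont_const.
  - now apply curve_cont_mul.
Qed.

Definition circ (rad theta : R) : C := (rad * cos theta, rad * sin theta).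

Lemma circ_deriv (rad theta : R) : curve_deriv (circ rad) theta (Ci * circ rad theta)%C.
Proof. split; simpl; auto_derive; auto; ring. Qed.

Lemma Cmod_circ (rad theta : R) : 0 <= rad -> Cmod (circ rad theta) = rad.
Proof.
  intros H. unfold Cmod, circ; simpl.
  replace (_ + _) with (Rsqr rad * (Rsqr (sin theta) + Rsqr (cos theta)))
    by (unfold Rsqr; ring).
  rewrite sin2_cos2, Rmult_1_r. now apply sqrt_Rsqr.
Qed.

Lemma circ_neq_0 (rad theta : R) : 0 < rad -> circ rad theta <> Complex.RtoC 0.
Proof. intros H. apply Cmod_gt_0. rewrite Cmod_circ; lra. Qed.

Lemma circ_2PI (rad : R) : circ rad (2 * PI) = circ rad 0.
Proof. unfold circ. rewrite cos_2PI, sin_2PI, cos_0, sin_0. reflexivity. Qed.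

Lemma curve_cont_circ (rad : R) : curve_cont (circ rad).
Proof. eapply curve_cont_deriv, circ_deriv. Qed.

Lemma circ_exp_deriv (rad theta : R) (z : C) :
  curve_deriv (fun t => Cexp (z * circ rad t)%C) theta
    (Cexp (z * circ rad theta) * (z * (Ci * circ rad theta)))%C.
Proof.
  apply (curve_deriv_exp (fun t => (z * circ rad t)%C)).
  eapply curve_deriv_val.
  - apply (curve_deriv_mul (fun _ => z)); [apply curve_deriv_const|apply circ_deriv].
  - ring.
Qed.

Lemma curve_cont_circ_exp (rad : R) (z : C) :
  curve_cont (fun t => Cexp (z * circ rad t)%C).
Proof. eapply curve_cont_deriv. intros s. apply circ_exp_deriv. Qed.

(** Since [dw = i w dtheta], the contour integral of [k] divided by [2 pi i] is the mean of
    [w k(w)]; this is the origin of the factor [circ rad t] in the integrands below. *)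
Definition circle_mean (g : R -> C) : C :=
  (/ (2 * PI) * RInt.RInt (fun t => fst (g t)) 0 (2 * PI),
   / (2 * PI) * RInt.RInt (fun t => snd (g t)) 0 (2 * PI)).

Lemma ex_RInt_circle (f : R -> R) :
  (forall s : R, continuous f s) -> ex_RInt f 0 (2 * PI).
Proof. intros H. apply (ex_RInt_continuous (V:=R_CompleteNormedModule)). auto. Qed.

Lemma circle_mean_ext (f g : R -> C) :
  (forall t, f t = g t) -> circle_mean f = circle_mean g.
Proof.
  intros E. unfold circle_mean. f_equal; f_equal; apply RInt_ext; intros; now rewrite E.
Qed.

Lemma circle_mean_lin (f g : R -> C) (c : C) : curve_cont f -> curve_cont g ->
  circle_mean (fun t => f t + c * g t)%C = (circle_mean f + c * circle_mean g)%C.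
Proof.
  intros Hf Hg. unfold circle_mean.
  set (F1 := fun t => fst (f t)). set (F2 := fun t => snd (f t)).
  set (G1 := fun t => fst (g t)). set (G2 := fun t => snd (g t)).
  assert (X1 : ex_RInt F1 0 (2 * PI)) by (apply ex_RInt_circle; intros; apply Hf).
  assert (X2 : ex_RInt F2 0 (2 * PI)) by (apply ex_RInt_circle; intros; apply Hf).
  assert (Y1 : ex_RInt G1 0 (2 * PI)) by (apply ex_RInt_circle; intros; apply Hg).
  assert (Y2 : ex_RInt G2 0 (2 * PI)) by (apply ex_RInt_circle; intros; apply Hg).
  assert (L : forall (p q r : R -> R) (a b : R),
    ex_RInt p 0 (2 * PI) -> ex_RInt q 0 (2 * PI) -> ex_RInt r 0 (2 * PI) ->
    RInt.RInt (fun t => p t + (a * q t + b * r t)) 0 (2 * PI) =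
    RInt.RInt p 0 (2 * PI) + (a * RInt.RInt q 0 (2 * PI) + b * RInt.RInt r 0 (2 * PI))).
  { intros p q r a b Hp Hq Hr. apply is_RInt_unique.
    apply (is_RInt_plus p); [now apply (RInt_correct (V:=R_CompleteNormedModule))|].
    apply (is_RInt_plus (fun t => a * q t)).
    - apply (is_RInt_scal q); now apply (RInt_correct (V:=R_CompleteNormedModule)).
    - apply (is_RInt_scal r); now apply (RInt_correct (V:=R_CompleteNormedModule)). }
  unfold Cplus, Cmult; simpl. f_equal.
  - rewrite (RInt_ext _ (fun t => F1 t + (fst c * G1 t + (- snd c) * G2 t))).
    + rewrite L by assumption. ring.
    + intros; unfold F1, G1, G2; apply Rminus_diag_uniq; cbv beta; ring.
  - rewrite (RInt_ext _ (fun t => F2 t + (fst c * G2 t + snd c * G1 t))).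
    + rewrite L by assumption. ring.
    + intros; unfold F2, G1, G2; apply Rminus_diag_uniq; cbv beta; ring.
Qed.

Lemma circle_mean_le (g : R -> C) (M : R) : curve_cont g ->
  (forall t, Cmod (g t) <= M) -> Cmod (circle_mean g) <= 2 * M.
Proof.
  intros Hg HM. pose proof PI_RGT_0.
  assert (P : forall f : R -> R, (forall s : R, continuous f s) -> (forall t, Rabs (f t) <= M) ->
    Rabs (/ (2 * PI) * RInt.RInt f 0 (2 * PI)) <= M).
  { intros f Hf HfM. rewrite Rabs_mult, Rabs_pos_eq by (left; apply Rinv_0_lt_compat; lra).
    pose proof (abs_RInt_le_const f 0 (2 * PI) M ltac:(lra) (ex_RInt_circle f Hf)
      (fun t _ => HfM t)) as Q.
    apply Rmult_le_reg_l with (2 * PI); [lra|].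
    rewrite <- Rmult_assoc, Rinv_r by lra. lra. }
  apply Cmod_le_fst_snd; simpl; apply P; try (intros; apply Hg); intros t;
    eapply Rle_trans; [apply fst_le_Cmod|auto|apply snd_le_Cmod|auto].
Qed.

Lemma circle_mean_const (c : C) : circle_mean (fun _ => c) = c.
Proof.
  unfold circle_mean. rewrite !RInt_const. unfold scal; simpl; unfold mult; simpl.
  pose proof PI_RGT_0. destruct c; simpl; f_equal; field; lra.
Qed.

(** Fundamental theorem of calculus on a closed curve; this stands in for Cauchy's theorem. *)
Lemma circle_mean_deriv (G g : R -> C) : curve_cont g ->
  (forall s, curve_deriv G s (g s)) -> G (2 * PI) = G 0 ->
  circle_mean g = Complex.RtoC 0.
Proof.
  intros Hg HG E. unfold circle_mean, Complex.RtoC. f_equal.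
  - rewrite (is_RInt_unique (fun t => fst (g t)) 0 (2 * PI) (minus (fst (G (2 * PI))) (fst (G 0)))).
    + rewrite E, minus_eq_zero. unfold zero; simpl; ring.
    + apply (is_RInt_derive (fun t => fst (G t))); intros; [apply HG|apply Hg].
  - rewrite (is_RInt_unique (fun t => snd (g t)) 0 (2 * PI) (minus (snd (G (2 * PI))) (snd (G 0)))).
    + rewrite E, minus_eq_zero. unfold zero; simpl; ring.
    + apply (is_RInt_derive (fun t => snd (G t))); intros; [apply HG|apply Hg].
Qed.

(** Strips the constants, such as [z i] or [- p i], produced by differentiating a primitive in
    [theta]. *)
Lemma circle_mean_zero_of_scal (g : R -> C) (c : C) : curve_cont g -> c <> Complex.RtoC 0 ->
  circle_mean (fun t => c * g t)%C = Complex.RtoC 0 -> circle_mean g = Complex.RtoC 0.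
Proof.
  intros Hg Hc H.
  rewrite (circle_mean_ext _ (fun t => Complex.RtoC 0 + c * g t)%C) in H by (intros; ring).
  rewrite (circle_mean_lin (fun _ => Complex.RtoC 0)), circle_mean_const, Cplus_0_l in H
    by auto using curve_cont_const.
  replace (circle_mean g) with (/ c * (c * circle_mean g))%C by (field; auto).
  rewrite H. ring.
Qed.

(** The integral of [e^(zw)] over the circle. Up to a constant the primitive is [e^(zw)], which says
    nothing for [z = 0]; there [w] itself is a primitive. *)
Lemma circle_mean_circ_exp (rad : R) (z : C) :
  circle_mean (fun t => circ rad t * Cexp (z * circ rad t))%C = Complex.RtoC 0.
Proof.
  assert (Ci_neq : Ci <> Complex.RtoC 0) by (apply Cmod_gt_0; rewrite Cmod_Ci; lra).
  assert (Hc : curve_cont (fun t => circ rad t * Cexp (z * circ rad t))%C)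
    by (apply curve_cont_mul; [apply curve_cont_circ|apply curve_cont_circ_exp]).
  destruct (excluded_middle_informative (z = Complex.RtoC 0)) as [->|Hz].
  - apply circle_mean_zero_of_scal with Ci; auto.
    apply (circle_mean_deriv (circ rad)); [apply curve_cont_mul; auto using curve_cont_const| |apply circ_2PI].
    intros s. eapply curve_deriv_val; [apply circ_deriv|].
    rewrite Cmult_0_l, Cexp_0. ring.
  - apply circle_mean_zero_of_scal with (z * Ci)%C; auto using Cmult_neq_0.
    apply (circle_mean_deriv (fun t => Cexp (z * circ rad t)%C));
      [apply curve_cont_mul; auto using curve_cont_const| |now rewrite circ_2PI].
    intros s. eapply curve_deriv_val; [apply circ_exp_deriv|]. ring.
Qed.

Lemma curve_deriv_inv_circ_pow (rad theta : R) (p : nat) : 0 < rad ->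
  curve_deriv (fun t => (/ circ rad t) ^ p)%C theta
    (- (INR p * Ci) * (/ circ rad theta) ^ p)%C.
Proof.
  intros Hr. induction p.
  - simpl. eapply curve_deriv_val; [apply curve_deriv_const|]. ring.
  - assert (D : curve_deriv (fun t => / circ rad t)%C theta (- Ci * / circ rad theta)%C).
    { assert (E : forall t, (/ circ rad t)%C = ((/ rad * cos t, - / rad * sin t) : C)).
      { intros t. pose proof (sin2_cos2 t) as Q. unfold Rsqr in Q. unfold Complex.Cinv, circ; simpl.
        replace (_ + _) with (rad * rad * (sin t * sin t + cos t * cos t)) by ring.
        rewrite Q. f_equal; field; lra. }
      apply (curve_deriv_ext (fun t => ((/ rad * cos t, - / rad * sin t) : C))).
      - intros; now rewrite E.
      - rewrite E. split; simpl; auto_derive; auto; ring. }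
    eapply curve_deriv_val; [apply (curve_deriv_mul _ _ _ _ _ D IHp)|].
    rewrite S_INR, RtoC_plus. simpl. ring.
Qed.

Lemma circle_mean_inv_circ_pow (rad : R) (p : nat) : 0 < rad ->
  circle_mean (fun t => (/ circ rad t) ^ S p)%C = Complex.RtoC 0.
Proof.
  intros Hr.
  assert (Hc : curve_cont (fun t => (/ circ rad t) ^ S p)%C).
  { eapply curve_cont_deriv. intros s. now apply curve_deriv_inv_circ_pow. }
  apply circle_mean_zero_of_scal with (- (INR (S p) * Ci))%C; auto.
  - apply Cmod_gt_0. rewrite Cmod_opp, Cmod_mult, Cmod_R, Cmod_Ci, Rmult_1_r.
    apply Rabs_pos_lt. now apply not_0_INR.
  - apply (circle_mean_deriv (fun t => (/ circ rad t) ^ S p)%C);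
      [apply curve_cont_mul; auto using curve_cont_const| |now rewrite circ_2PI].
    intros s. now apply curve_deriv_inv_circ_pow.
Qed.

(** The difference quotient error has integrand [g e^(zw) (e^(hw) - 1 - hw)], and [|hw| = |h| rad]
    on the whole circle, so [Cexp_deriv_0] applies uniformly in [t]. *)
Lemma circle_transform_deriv (rad : R) (g : R -> C) (M : R) (z : C) : 0 < rad ->
  curve_cont g -> (forall t, Cmod (g t) <= M) ->
  complex_deriv (fun z => circle_mean (fun t => g t * Cexp (z * circ rad t))%C) z
    (circle_mean (fun t => g t * circ rad t * Cexp (z * circ rad t))%C).
Proof.
  intros Hr Hg HM eps He.
  assert (HM0 : 0 <= M) by (eapply Rle_trans; [apply Cmod_ge_0|apply (HM 0)]).
  (* The leading 2 is the loss in [circle_mean_le], the last [rad] comes from [|hw|], and [M + 1]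
     keeps [K] positive when [M = 0]. *)
  set (K := 2 * ((M + 1) * exp (Cmod z * rad) * rad)).
  assert (HK : 0 < K).
  { unfold K. pose proof (exp_pos (Cmod z * rad)).
    apply Rmult_lt_0_compat; [lra|]. apply Rmult_lt_0_compat; [|lra].
    apply Rmult_lt_0_compat; lra. }
  destruct (Cexp_deriv_0 (eps / K)) as [d [Hd H']]; [now apply Rdiv_lt_0_compat|].
  exists (d / rad). split; [now apply Rdiv_lt_0_compat|].
  intros h Hh. apply Rlt_div_r in Hh; auto.
  assert (C1 : forall z, curve_cont (fun t => g t * Cexp (z * circ rad t))%C)
    by (intros; apply curve_cont_mul; auto using curve_cont_circ_exp).
  assert (C2 : curve_cont (fun t => g t * circ rad t * Cexp (z * circ rad t))%C)
    by (repeat apply curve_cont_mul; auto using curve_cont_circ_exp, curve_cont_circ).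
  set (k := fun t => (g t * Cexp (z * circ rad t) *
     (Cexp (h * circ rad t) - 1 - h * circ rad t))%C).
  assert (Ek : forall t, k t = (g t * Cexp ((z + h) * circ rad t)
      + (- (1)) * (g t * Cexp (z * circ rad t))
      + (- h) * (g t * circ rad t * Cexp (z * circ rad t)))%C).
  { intros t. unfold k. rewrite Cmult_plus_distr_r, Cexp_add. ring. }
  replace (_ - _ - _)%C with (circle_mean k).
  2:{ rewrite (circle_mean_ext _ _ Ek).
      rewrite (circle_mean_lin (fun t => (g t * Cexp ((z + h) * circ rad t)
        + (- (1)) * (g t * Cexp (z * circ rad t)))%C)), circle_mean_lin; auto.
      - ring.
      - apply curve_cont_add; auto. apply curve_cont_mul; auto using curve_cont_const. }
  replace (eps * Cmod h) with (2 * ((M + 1) * exp (Cmod z * rad) * (eps / K * (Cmod h * rad)))).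
  2:{ unfold K. pose proof (exp_pos (Cmod z * rad)). field. repeat split; lra. }
  apply circle_mean_le.
  - apply (curve_cont_ext _ _ (fun t => eq_sym (Ek t))).
    apply curve_cont_add; [apply curve_cont_add; [apply C1|]|];
      (apply curve_cont_mul; [apply curve_cont_const|auto]).

  - intros t. unfold k; cbv beta. rewrite !Cmod_mult.
    assert (Hw : Cmod (h * circ rad t)%C = Cmod h * rad)
      by (rewrite Cmod_mult, Cmod_circ; lra).
    specialize (H' (h * circ rad t)%C). rewrite Hw in H'.
    assert (Cmod (Cexp (z * circ rad t)%C) <= exp (Cmod z * rad)).
    { eapply Rle_trans; [apply Cmod_Cexp_le|].
      apply exp_le_mono. rewrite Cmod_mult, Cmod_circ; lra. }
    apply Rmult_le_compat; auto using Cmod_ge_0.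
    + apply Rmult_le_pos; apply Cmod_ge_0.
    + apply Rmult_le_compat; auto using Cmod_ge_0. specialize (HM t). lra.
Qed.

(** * The fundamental functions *)

Lemma Rabs_le_maxabs (lam : nat -> R) (n j : nat) : (j <= n)%nat -> Rabs (lam j) <= maxabs lam n.
Proof.
  induction n; intros H; simpl.
  - replace j with O by lia. lra.
  - destruct (Nat.eq_dec j (S n)) as [->|E]; [apply Rmax_r|].
    eapply Rle_trans; [apply IHn; lia|apply Rmax_l].
Qed.

Lemma maxabs_ge_0 (lam : nat -> R) (n : nat) : 0 <= maxabs lam n.
Proof. eapply Rle_trans; [apply Rabs_pos|apply (Rabs_le_maxabs lam n O); lia]. Qed.

Lemma Cmod_circ_sub_ge (rad theta l : R) : 0 <= rad ->
  rad - Rabs l <= Cmod (circ rad theta - l)%C.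
Proof.
  intros H. eapply Rle_trans; [|apply Cmod_triangle_rev].
  rewrite Cmod_circ, Cmod_R; lra.
Qed.

Lemma Cinv_prod (x y : C) : x <> Complex.RtoC 0 -> y <> Complex.RtoC 0 ->
  (/ (x * y))%C = (/ x * / y)%C.
Proof. intros; field; auto. Qed.

Definition lin_prod (lam : nat -> R) (n : nat) (rad theta : R) : C :=
  Cprod_lin lam n (circ rad theta).

Lemma lin_prod_0 (lam : nat -> R) (rad theta : R) :
  lin_prod lam 0 rad theta = (circ rad theta - lam O)%C.
Proof. reflexivity. Qed.

Lemma lin_prod_S (lam : nat -> R) (n : nat) (rad theta : R) :
  lin_prod lam (S n) rad theta = (lin_prod lam n rad theta * (circ rad theta - lam (S n)))%C.
Proof. reflexivity. Qed.

Lemma circ_sub_neq_0 (lam : nat -> R) (n j : nat) (rad theta : R) :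
  (j <= n)%nat -> maxabs lam n < rad -> (circ rad theta - lam j)%C <> Complex.RtoC 0.
Proof.
  intros Hj Hr. apply Cmod_gt_0. pose proof (Rabs_le_maxabs lam n j Hj).
  pose proof (maxabs_ge_0 lam n). pose proof (Cmod_circ_sub_ge rad theta (lam j)). lra.
Qed.

Lemma maxabs_S_lt (lam : nat -> R) (n : nat) (rad : R) :
  maxabs lam (S n) < rad -> maxabs lam n < rad.
Proof. intros H. eapply Rle_lt_trans; [apply Rmax_l|exact H]. Qed.

Lemma lin_prod_neq_0 (lam : nat -> R) (n : nat) (rad theta : R) :
  maxabs lam n < rad -> lin_prod lam n rad theta <> Complex.RtoC 0.
Proof.
  induction n; intros H.
  - now apply (circ_sub_neq_0 lam 0).
  - rewrite lin_prod_S. apply Cmult_neq_0; [now apply IHn, maxabs_S_lt|].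
    now apply (circ_sub_neq_0 lam (S n)).
Qed.

Lemma curve_cont_lin_prod (lam : nat -> R) (n : nat) (rad : R) :
  curve_cont (lin_prod lam n rad).
Proof.
  assert (P : forall l : R, curve_cont (fun t => circ rad t - l)%C).
  { intros l. apply (curve_cont_add (circ rad) (fun _ => Complex.Copp l));
      [apply curve_cont_circ|apply curve_cont_const]. }
  induction n; [apply P|]. apply (curve_cont_mul (lin_prod lam n rad)); [apply IHn|apply P].
Qed.

Lemma Cmod_inv_lin_prod_bounded (lam : nat -> R) (n : nat) (rad : R) : maxabs lam n < rad ->
  exists M, forall t, Cmod (/ lin_prod lam n rad t)%C <= M.
Proof.
  assert (P : forall k j t, (j <= k)%nat -> maxabs lam k < rad ->
    Cmod (/ (circ rad t - lam j))%C <= / (rad - maxabs lam k)).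
  { intros k j t Hj H. rewrite Cmod_inv by now apply (circ_sub_neq_0 lam k).
    pose proof (Rabs_le_maxabs lam k j Hj). pose proof (maxabs_ge_0 lam k).
    pose proof (Cmod_circ_sub_ge rad t (lam j)). apply Rinv_le_contravar; lra. }
  induction n; intros H.
  - eexists. intros t. now apply (P O).
  - destruct IHn as [M HM]; [now apply maxabs_S_lt|].
    exists (M * / (rad - maxabs lam (S n))). intros t.
    pose proof (lin_prod_neq_0 lam n rad t (maxabs_S_lt _ _ _ H)).
    pose proof (circ_sub_neq_0 lam (S n) (S n) rad t (le_n _) H).
    rewrite lin_prod_S, Cinv_prod, Cmod_mult by auto.
    apply Rmult_le_compat; try apply Cmod_ge_0; [apply HM|now apply (P (S n))].
Qed.

Lemma curve_cont_inv_lin_prod (lam : nat -> R) (n : nat) (rad : R) : maxabs lam n < rad ->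
  curve_cont (fun t => / lin_prod lam n rad t)%C.
Proof.
  intros H. apply curve_cont_inv; [apply curve_cont_lin_prod|].
  intros; now apply lin_prod_neq_0.
Qed.

(** Unrolling gives [a p = l^k a (k + p)], of size at most a constant times [(|l| / rad)^k], for
    every [k]. *)
Lemma eq_0_of_geometric_recursion (a : nat -> C) (l rad M : R) :
  Rabs l < rad -> (forall p, a p = (l * a (S p))%C) ->
  (forall p, Cmod (a p) <= M * (/ rad) ^ p) -> forall p, a p = Complex.RtoC 0.
Proof.
  intros Hl Ha HM p. pose proof (Rabs_pos l).
  assert (E : forall k, Cmod (a p) = Rabs l ^ k * Cmod (a (k + p)%nat)).
  { induction k; simpl; [ring|].
    rewrite IHk, (Ha (k + p)%nat), Cmod_mult, Cmod_R. ring. }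
  assert (B : forall k, Cmod (a p) <= (M * (/ rad) ^ p) * (Rabs l / rad) ^ k).
  { intros k. rewrite (E k). unfold Rdiv. rewrite Rpow_mult_distr.
    specialize (HM (k + p)%nat). rewrite pow_add in HM.
    apply Rle_trans with (Rabs l ^ k * (M * ((/ rad) ^ k * (/ rad) ^ p))).
    - apply Rmult_le_compat_l; auto. now apply pow_le.
    - right; ring. }
  apply Cmod_eq_0. apply Rle_antisym; [|apply Cmod_ge_0].
  assert (L : is_lim_seq (fun k => (M * (/ rad) ^ p) * (Rabs l / rad) ^ k) 0).
  { replace (Finite 0) with (Rbar_mult (M * (/ rad) ^ p) 0) by (simpl; f_equal; ring).
    apply is_lim_seq_scal_l. apply is_lim_seq_geom.
    rewrite Rabs_pos_eq; [apply Rlt_div_l; lra|].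
    apply Rdiv_le_0_compat; lra. }
  exact (is_lim_seq_le _ _ (Cmod (a p)) 0 B (is_lim_seq_const _) L).
Qed.

Lemma inv_circ_sub (rad t l : R) : 0 < rad -> (circ rad t - l)%C <> Complex.RtoC 0 ->
  (/ (circ rad t - l))%C = (/ circ rad t + l * (/ circ rad t * / (circ rad t - l)))%C.
Proof. intros Hr H. pose proof (circ_neq_0 rad t Hr). field. auto. Qed.

(* The expansion [1/(w - l) = 1/w + l/(w (w - l))] relates the [p]-th moment to the
   [(p+1)]-st, and the moments decay like [rad ^ (-p)], faster than the powers of [l] grow. *)
Lemma circle_mean_moment (lam : nat -> R) (n : nat) (rad : R) : maxabs lam n < rad ->
  forall p : nat,
  circle_mean (fun t => circ rad t * (/ circ rad t) ^ p * / lin_prod lam n rad t)%C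
   = Complex.RtoC (match n, p with O, O => 1 | _, _ => 0 end).
Proof.
  assert (Bd : forall n rad, maxabs lam n < rad -> exists M, forall p,
    Cmod (circle_mean (fun t => circ rad t * (/ circ rad t) ^ p * / lin_prod lam n rad t)%C)
      <= M * (/ rad) ^ p).
  { intros k r H. destruct (Cmod_inv_lin_prod_bounded lam k r H) as [M HM].
    pose proof (maxabs_ge_0 lam k). exists (2 * (r * M)). intros p.
    replace (2 * (r * M) * (/ r) ^ p) with (2 * (r * (/ r) ^ p * M)) by ring.
    apply circle_mean_le.
    - apply curve_cont_mul; [apply curve_cont_mul|now apply curve_cont_inv_lin_prod].
      + apply curve_cont_circ.
      + apply curve_cont_pow, curve_cont_inv; [apply curve_cont_circ|].
        intros; apply circ_neq_0; lra.
    - intros t. rewrite !Cmod_mult, Cmod_pow, Cmod_inv, Cmod_circ by (try apply circ_neq_0; lra).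
      apply Rmult_le_compat_l; auto. apply Rmult_le_pos; [lra|].
      apply pow_le. left. apply Rinv_0_lt_compat; lra. }
  (* Expanding the last factor removes it from the product in the first mean; for [n = 0] no product
     is left and that mean is the one of [w^(-p)]. *)
  assert (Rec : forall n rad p, maxabs lam n < rad ->
    circle_mean (fun t => circ rad t * (/ circ rad t) ^ p * / lin_prod lam n rad t)%C =
    (circle_mean (match n with
       | O => fun t => (/ circ rad t) ^ p
       | S m => fun t => circ rad t * (/ circ rad t) ^ (S p) * / lin_prod lam m rad t end) +
     lam n * circle_mean (fun t => circ rad t * (/ circ rad t) ^ (S p) * / lin_prod lam n rad t))%C).
  { intros k r p H. pose proof (maxabs_ge_0 lam k).
    assert (Hi : curve_cont (fun t => / circ r t)%C)
      by (apply curve_cont_inv; [apply curve_cont_circ|intros; apply circ_neq_0; lra]).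
    assert (HJ : forall q j, maxabs lam j < r ->
      curve_cont (fun t => circ r t * (/ circ r t) ^ q * / lin_prod lam j r t)%C).
    { intros q j Hj. apply curve_cont_mul; [apply curve_cont_mul|now apply curve_cont_inv_lin_prod].
      - apply curve_cont_circ.
      - now apply curve_cont_pow. }
    rewrite <- circle_mean_lin.
    - apply circle_mean_ext. intros t.
      assert (Hw : circ r t <> Complex.RtoC 0) by (apply circ_neq_0; lra).
      assert (Hwl : (circ r t - lam k)%C <> Complex.RtoC 0) by now apply (circ_sub_neq_0 lam k).
      destruct k as [|k].
      + rewrite lin_prod_0, inv_circ_sub at 1 by (auto; lra). simpl.
        replace (circ r t * (/ circ r t) ^ p * (/ circ r t + lam O * (/ circ r t * / (circ r t - lam O))))%C
          with ((circ r t * / circ r t) * (/ circ r t) ^ p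
            + lam O * (circ r t * (/ circ r t * (/ circ r t) ^ p) * / (circ r t - lam O)))%C by ring.
        rewrite Cinv_r by auto. rewrite lin_prod_0. ring.
      + pose proof (lin_prod_neq_0 lam k r t (maxabs_S_lt lam k r H)).
        rewrite lin_prod_S, Cinv_prod by auto.
        rewrite inv_circ_sub at 1 by (auto; lra). simpl. ring.
    - destruct k; [now apply curve_cont_pow|now apply HJ, maxabs_S_lt].
    - now apply HJ. }
  intros H. assert (Hr : 0 < rad) by (pose proof (maxabs_ge_0 lam n); lra).
  assert (Hl : Rabs (lam n) < rad) by (pose proof (Rabs_le_maxabs lam n n (le_n n)); lra).
  induction n as [|n IHn].
  (* Moments of positive index obey a homogeneous recursion and vanish; index 0 then reduces to the
     mean of the constant 1. *)
  - assert (P : forall p, circle_mean (fun t => circ rad t * (/ circ rad t) ^ (S p)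
        * / lin_prod lam 0 rad t)%C = Complex.RtoC 0).
    { destruct (Bd O rad H) as [M HM].
      apply eq_0_of_geometric_recursion with (l := lam O) (rad := rad) (M := M * / rad); auto.
      - intros p. rewrite Rec by auto. rewrite circle_mean_inv_circ_pow by auto. ring.
      - intros p. eapply Rle_trans; [apply HM|]. right; simpl; ring. }
    intros [|p]; [|apply P].
    rewrite Rec, P by auto. simpl. rewrite circle_mean_const. ring.
  - assert (H' := maxabs_S_lt lam n rad H).
    specialize (IHn H' ltac:(pose proof (Rabs_le_maxabs lam n n (le_n n)); lra)).
    destruct (Bd (S n) rad H) as [M HM].
    (* The inhomogeneous term is a moment of index [S p] for the shorter product. It vanishes even
       for [n = 0], so here the recursion is homogeneous from [p = 0] on. *)
    apply eq_0_of_geometric_recursion with (l := lam (S n)) (rad := rad) (M := M); auto.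
    intros p. rewrite Rec by auto. rewrite IHn. destruct n; ring.
Qed.

(** The radius is a parameter so that functions of different order can be written over the same
    circle. *)
Definition fund (rad : R) (lam : nat -> R) (n : nat) (z : C) : C :=
  circle_mean (fun t => circ rad t * / lin_prod lam n rad t * Cexp (z * circ rad t))%C.

Lemma fund_at_0 (rad : R) (lam : nat -> R) (n : nat) : maxabs lam n < rad ->
  fund rad lam n (Complex.RtoC 0) = Complex.RtoC (match n with O => 1 | _ => 0 end).
Proof.
  intros H. pose proof (circle_mean_moment lam n rad H O) as E. unfold fund.
  rewrite (circle_mean_ext _ (fun t => circ rad t * (/ circ rad t) ^ 0 * / lin_prod lam n rad t)%C).
  - rewrite E. destruct n; reflexivity.
  - intros t. rewrite Cmult_0_l, Cexp_0. simpl. ring.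
Qed.

(** Differentiation brings down [w = (w - lam_n) + lam_n], and [w - lam_n] cancels the last factor
    of the product. For [n = 0] this leaves the integral of [e^(zw)], which is 0. *)
Lemma fund_deriv (rad : R) (lam : nat -> R) (n : nat) (z : C) : maxabs lam n < rad ->
  complex_deriv (fund rad lam n) z
    (match n with O => Complex.RtoC 0 | S m => fund rad lam m z end + lam n * fund rad lam n z)%C.
Proof.
  intros H. assert (Hr : 0 < rad) by (pose proof (maxabs_ge_0 lam n); lra).
  assert (Hc : forall j, maxabs lam j < rad -> curve_cont (fun t => circ rad t * / lin_prod lam j rad t)%C)
    by (intros; apply curve_cont_mul; [apply curve_cont_circ|now apply curve_cont_inv_lin_prod]).
  assert (Hce : forall j, maxabs lam j < rad ->
    curve_cont (fun t => circ rad t * / lin_prod lam j rad t * Cexp (z * circ rad t))%C)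
    by (intros; apply curve_cont_mul; [now apply Hc|apply curve_cont_circ_exp]).
  destruct (Cmod_inv_lin_prod_bounded lam n rad H) as [M HM].
  assert (D := circle_transform_deriv rad (fun t => circ rad t * / lin_prod lam n rad t)%C
    (rad * M) z Hr (Hc n H)).
  match type of D with _ -> complex_deriv _ _ ?e =>
    replace (_ + _)%C with e; [apply D|] end.
  { intros t. rewrite Cmod_mult, Cmod_circ by lra. apply Rmult_le_compat_l; auto; lra. }
  destruct n as [|n].
  - rewrite <- (circle_mean_circ_exp rad z). unfold fund.
    rewrite <- circle_mean_lin; auto.
    + apply circle_mean_ext. intros t. rewrite lin_prod_0.
      pose proof (circ_sub_neq_0 lam 0 0 rad t (le_n _) H). field. auto.
    + apply curve_cont_mul; [apply curve_cont_circ|apply curve_cont_circ_exp].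
  - unfold fund. assert (H' := maxabs_S_lt lam n rad H).
    rewrite <- circle_mean_lin; auto.
    apply circle_mean_ext. intros t. rewrite lin_prod_S.
    pose proof (circ_sub_neq_0 lam (S n) (S n) rad t (le_n _) H).
    pose proof (lin_prod_neq_0 lam n rad t H'). field. auto.
Qed.

(* Variation of constants, with [|exp(l z (1 - s))| <= exp(|l| |z| (1 - s))]. *)
Lemma complex_ode_comparison (u v : C -> C) (l : R) (G G' : R -> R) (z : C) :
  (forall z, complex_deriv u z (v z + l * u z)%C) ->
  (forall s, is_derive G s (G' s)) ->
  (forall z, Cmod (v z) + Rabs l * G (Cmod z) <= G' (Cmod z)) ->
  Cmod (u (Complex.RtoC 0)) <= G 0 ->
  Cmod (u z) <= G (Cmod z).
Proof.
  intros Hu HG Hle H0. set (r := Cmod z). assert (Hr : 0 <= r) by apply Cmod_ge_0.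
  (* Along [s z] the factor [exp(l z (1 - s))] removes the term [l u] and equals 1 at the end
     [s = 1]; the comparison function carries the same weight with [|l|] and [r]. *)
  pose proof (curve_mean_value
    (fun s => Cexp (l * z + s * (- (l * z))) * u (0 + s * z))%C
    (fun s => z * (Cexp (l * z + s * (- (l * z))) * v (0 + s * z)))%C
    (fun s => exp (Rabs l * r * (1 - s)) * G (s * r))
    (fun s => r * (exp (Rabs l * r * (1 - s)) * (G' (s * r) - Rabs l * G (s * r)))) 0 1) as P.
  cbv beta in P.
  replace (l * z + 1 * - (l * z))%C with (Complex.RtoC 0) in P by ring.
  replace (0 + 1 * z)%C with z in P by ring.
  replace (0 + 0 * z)%C with (Complex.RtoC 0) in P by ring.
  replace (l * z + 0 * - (l * z))%C with (l * z)%C in P by ring.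
  replace (Rabs l * r * (1 - 1)) with 0 in P by ring.
  replace (Rabs l * r * (1 - 0)) with (Rabs l * r) in P by ring.
  rewrite Cexp_0, exp_0, Cmult_1_l, !Rmult_1_l, Rmult_0_l in P.
  assert (B : forall s, 0 <= s <= 1 ->
    Cmod (Cexp (l * z + s * (- (l * z)))%C) <= exp (Rabs l * r * (1 - s))).
  { intros s Hs. eapply Rle_trans; [apply Cmod_Cexp_le|]. apply exp_le_mono.
    replace (l * z + s * - (l * z))%C with (l * ((1 - s)%R * z))%C
      by (rewrite RtoC_minus; ring).
    rewrite !Cmod_mult, !Cmod_R, (Rabs_pos_eq (1 - s)) by lra. fold r. right; ring. }
  assert (Q : Cmod (u z - Cexp (l * z) * u (Complex.RtoC 0))%C <= G r - exp (Rabs l * r) * G 0).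
  { apply P; [lra| | |].
    - intros s Hs. eapply curve_deriv_val.
      + apply curve_deriv_mul.
        * apply (curve_deriv_exp (fun s => l * z + s * (- (l * z)))%C), curve_deriv_affine.
        * apply complex_deriv_line, Hu.
      + cbv beta. ring.
    - intros s Hs. assert (DG : is_derive (fun s => G (s * r)) s (r * G' (s * r))).
      { apply (is_derive_comp G (fun s => s * r)); [apply HG|]. auto_derive; auto; ring. }
      assert (DE : is_derive (fun s => exp (Rabs l * r * (1 - s))) s
        (- (Rabs l * r) * exp (Rabs l * r * (1 - s)))).
      { auto_derive; auto. unfold Rminus; ring. }
      replace (r * _) with (- (Rabs l * r) * exp (Rabs l * r * (1 - s)) * G (s * r)
        + exp (Rabs l * r * (1 - s)) * (r * G' (s * r))) by ring.
      exact (is_derive_mult _ _ s _ _ DE DG Rmult_comm).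
    - intros s Hs. rewrite Cmod_mult. apply Rmult_le_compat_l; auto.
      rewrite Cmod_mult. apply Rmult_le_compat; auto using Cmod_ge_0.
      specialize (Hle (0 + s * z)%C).
      assert (E : Cmod (0 + s * z)%C = s * r)
        by (rewrite Cplus_0_l, Cmod_mult, Cmod_R, Rabs_pos_eq; [reflexivity|lra]).
      rewrite E in Hle. lra. }
  specialize (B 0 ltac:(lra)).
  replace (l * z + 0 * - (l * z))%C with (l * z)%C in B by ring.
  replace (Rabs l * r * (1 - 0)) with (Rabs l * r) in B by ring.
  pose proof (Cmod_triangle_rev (u z) (Cexp (l * z)%C * u (Complex.RtoC 0))%C) as T.
  (* The contribution of the initial value is at most the term [exp(|l| r) G 0] subtracted in [Q],
     so the two cancel. *)
  assert (Cmod (Cexp (l * z)%C * u (Complex.RtoC 0))%C <= exp (Rabs l * r) * G 0).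
  { rewrite Cmod_mult. apply Rmult_le_compat; auto using Cmod_ge_0. }
  lra.
Qed.

(** By induction both sides solve the same first order equation with the same value at 0; comparison
    of the difference with the zero function gives equality. This replaces deformation of the
    contour. *)
Lemma fund_radius_indep (lam : nat -> R) (n : nat) (rad rad' : R) :
  maxabs lam n < rad -> maxabs lam n < rad' -> forall z, fund rad lam n z = fund rad' lam n z.
Proof.
  assert (Step : forall n, maxabs lam n < rad -> maxabs lam n < rad' ->
    (forall z, match n with O => Complex.RtoC 0 | S m => fund rad lam m z end =
      match n with O => Complex.RtoC 0 | S m => fund rad' lam m z end) ->
    forall z, fund rad lam n z = fund rad' lam n z).
  { intros k H H' Prev z.
    pose proof (complex_ode_comparison
      (fun z => fund rad lam k z + (- (1)) * fund rad' lam k z)%C (fun _ => Complex.RtoC 0)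
      (lam k) (fun _ => 0) (fun _ => 0) z) as P.
    cbv beta in P.
    assert (Q : Cmod (fund rad lam k z + - (1) * fund rad' lam k z)%C <= 0).
    { apply P.
      - intros y.
        match goal with |- complex_deriv _ _ ?e =>
          replace e with ((match k with O => Complex.RtoC 0 | S m => fund rad lam m y end
             + lam k * fund rad lam k y)
            + (- (1)) * (match k with O => Complex.RtoC 0 | S m => fund rad' lam m y end
             + lam k * fund rad' lam k y))%C
        end.
        + apply complex_deriv_lin; now apply fund_deriv.
        + rewrite Prev. ring.
      - intros s. apply @is_derive_const.
      - intros y. rewrite Cmod_0. lra.
      - rewrite !fund_at_0 by auto.
        replace (_ + _)%C with (Complex.RtoC 0) by ring. rewrite Cmod_0. lra. }
    assert (E : (fund rad lam k z + - (1) * fund rad' lam k z)%C = Complex.RtoC 0).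
    { apply Cmod_eq_0. apply Rle_antisym; [exact Q|apply Cmod_ge_0]. }
    replace (fund rad lam k z) with
      ((fund rad lam k z + - (1) * fund rad' lam k z) + fund rad' lam k z)%C by ring.
    rewrite E. ring. }
  induction n as [|n IHn]; intros H H'; apply Step; auto.
  apply IHn; now apply maxabs_S_lt.
Qed.

(** Integrability makes the description under [epsilon] satisfiable, and any integrability proof it
    is realised by has the same Riemann integral. *)
Lemma Defs_RInt_eq (f : R -> R) (a b : R) : ex_RInt f a b -> RInt f a b = RInt.RInt f a b.
Proof.
  intros H. unfold RInt.
  assert (E : exists v, exists pr : Riemann_integrable f a b, RiemannInt pr = v)
    by (exists (RiemannInt (ex_RInt_Reals_0 f a b H)), (ex_RInt_Reals_0 f a b H); reflexivity).
  destruct (epsilon_spec (inhabits 0) _ E) as [pr <-]. symmetry. apply RInt_Reals.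
Qed.

Lemma Defs_Cinv_eq (z : C) : Cinv z = (/ z)%C.
Proof. unfold Cinv, Complex.Cinv. f_equal; f_equal; ring. Qed.

Lemma Phi_fund (lam : nat -> R) (n : nat) (z : C) : Phi lam n z = fund (1 + maxabs lam n) lam n z.
Proof.
  set (rad := 1 + maxabs lam n). assert (H : maxabs lam n < rad) by (unfold rad; lra).
  assert (E : forall t, Phi_integrand lam n z t =
    (circ rad t * / lin_prod lam n rad t * Cexp (z * circ rad t))%C).
  { intros t. unfold Phi_integrand. rewrite Defs_Cinv_eq.
    fold rad. change (rad * cos t, rad * sin t) with (circ rad t).
    fold (lin_prod lam n rad t).
    change (circ rad t * Cexp (z * circ rad t) * / lin_prod lam n rad t =
      circ rad t * / lin_prod lam n rad t * Cexp (z * circ rad t))%C. ring. }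
  assert (Hc : curve_cont (Phi_integrand lam n z)).
  { apply (curve_cont_ext _ _ (fun t => eq_sym (E t))).
    apply curve_cont_mul; [apply curve_cont_mul|apply curve_cont_circ_exp].
    - apply curve_cont_circ.
    - now apply curve_cont_inv_lin_prod. }
  assert (X1 : ex_RInt (fun t => fst (Phi_integrand lam n z t)) 0 (2 * PI))
    by (apply ex_RInt_circle; intros s; exact (proj1 (Hc s))).
  assert (X2 : ex_RInt (fun t => snd (Phi_integrand lam n z t)) 0 (2 * PI))
    by (apply ex_RInt_circle; intros s; exact (proj2 (Hc s))).
  unfold Phi. rewrite (Defs_RInt_eq _ _ _ X1), (Defs_RInt_eq _ _ _ X2).
  unfold fund. rewrite <- (circle_mean_ext _ _ E). reflexivity.
Qed.

Lemma Phi_at_0 (lam : nat -> R) (n : nat) :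
  Phi lam n (Complex.RtoC 0) = Complex.RtoC (match n with O => 1 | _ => 0 end).
Proof. rewrite Phi_fund. apply fund_at_0. lra. Qed.

(** The convention [Phi_(-1) = 0] lets the recursion hold from [n = 0] on. *)
Definition Phi_prev (lam : nat -> R) (n : nat) (z : C) : C :=
  match n with O => Complex.RtoC 0 | S m => Phi lam m z end.

Definition Phi' (lam : nat -> R) (n : nat) (z : C) : C :=
  (Phi_prev lam n z + lam n * Phi lam n z)%C.

Lemma Phi_deriv (lam : nat -> R) (n : nat) (z : C) :
  complex_deriv (Phi lam n) z (Phi' lam n z).
Proof.
  apply complex_deriv_ext with (fund (1 + maxabs lam n) lam n);
    [intros; symmetry; apply Phi_fund|].
  unfold Phi', Phi_prev. rewrite Phi_fund.
  replace (match n with O => _ | S m => Phi lam m z end) with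
    (match n with O => Complex.RtoC 0 | S m => fund (1 + maxabs lam n) lam m z end).
  - apply fund_deriv. lra.
  (* [Phi lam n] is defined with its own, possibly smaller, radius; it is moved to the circle used
     for order [S n]. *)
  - destruct n as [|n]; auto. rewrite Phi_fund. apply fund_radius_indep; [|lra].
    apply maxabs_S_lt. lra.
Qed.

(* The fundamental function of the arithmetic progression [A, A + b, ..., A + n b]. *)
Definition Phi_bound (A b : R) (n : nat) (r : R) : R :=
  exp (A * r) * ((exp (b * r) - 1) / b) ^ n / INR (fact n).

Definition Phi_bound' (A b : R) (n : nat) (r : R) : R :=
  match n with O => 0 | S m => Phi_bound A b m r end + (A + b * INR n) * Phi_bound A b n r.

Lemma Phi_bound_deriv (A b : R) (n : nat) (r : R) : 0 < b ->
  is_derive (Phi_bound A b n) r (Phi_bound' A b n r).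
Proof.
  intros Hb. unfold Phi_bound', Phi_bound at 1.
  pose proof (INR_fact_neq_0 n). auto_derive; auto.
  destruct n as [|n]; unfold Phi_bound.
  - simpl. field. lra.
  - pose proof (INR_fact_neq_0 n). simpl pred. rewrite fact_simpl, mult_INR.
    assert (INR (S n) <> 0) by now apply not_0_INR.
    unfold Rminus, Rdiv. set (N := INR (S n)) in *.
    set (E := (exp (b * r) + - (1)) * / b).
    (* [E' = exp(b r) = 1 + b E]: the 1 produces the bound of order [n - 1], and [b E] produces the
       summand [b n] of the exponent. *)
    replace (exp (b * r)) with (1 + b * E) by (unfold E; field; lra).
    clearbody N E. simpl pow. field. repeat split; auto; lra.
Qed.

Lemma Phi_bound_ge_0 (A b : R) (n : nat) (r : R) : 0 < b -> 0 <= r -> 0 <= Phi_bound A b n r.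
Proof.
  intros Hb Hr. unfold Phi_bound.
  apply Rdiv_le_0_compat; [|apply INR_fact_lt_0].
  apply Rmult_le_pos; [left; apply exp_pos|]. apply pow_le.
  apply Rdiv_le_0_compat; [|lra].
  assert (exp 0 <= exp (b * r)) by (apply exp_le_mono; nra).
  rewrite exp_0 in *. lra.
Qed.

(** [Phi] and [Phi_bound] obey recursions of the same shape, with [|lam_n|] dominated by [A + b n],
    and agree at 0; the comparison lemma carries the bound from order to order. *)
Lemma Phi_le (lam : nat -> R) (A b : R) : 0 < b ->
  (forall n, Rabs (lam n) <= A + b * INR n) ->
  forall n z, Cmod (Phi lam n z) <= Phi_bound A b n (Cmod z).
Proof.
  intros Hb Hlam n. induction n as [|n IHn]; intros z.
  all: eapply (complex_ode_comparison _ (Phi_prev lam _) (lam _) _ (Phi_bound' A b _));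
    [intros; apply Phi_deriv|intros; now apply Phi_bound_deriv| |].
  - intros y. simpl Phi_prev. rewrite Cmod_0. unfold Phi_bound'.
    apply Rplus_le_compat_l. apply Rmult_le_compat_r; auto using Phi_bound_ge_0, Cmod_ge_0.
  - rewrite Phi_at_0, Cmod_R, Rabs_R1. unfold Phi_bound. rewrite Rmult_0_r, exp_0. simpl. lra.
  - intros y. simpl Phi_prev. unfold Phi_bound'.
    apply Rplus_le_compat; auto. apply Rmult_le_compat_r; auto using Phi_bound_ge_0, Cmod_ge_0.
  - rewrite Phi_at_0, Cmod_R, Rabs_R0. apply Phi_bound_ge_0; lra.
Qed.

(** * The differential operators D^(n) on an interval *)

Lemma mean_value_derive (f df : R -> R) (a b : R) : a <= b ->
  (forall x, a <= x <= b -> is_derive f x (df x)) ->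
  exists c, a <= c <= b /\ f b - f a = df c * (b - a).
Proof.
  intros Hab H. destruct (MVT_gen f a b df) as [c [Hc E]].
  - intros x Hx. rewrite Rmin_left, Rmax_right in Hx by lra. apply H; lra.
  - intros x Hx. rewrite Rmin_left, Rmax_right in Hx by lra.
    apply derivable_continuous_pt. eexists. apply is_derive_Reals, (H x Hx).
  - rewrite Rmin_left, Rmax_right in Hc by lra. eauto.
Qed.

Definition clamp (a b t : R) : R := Rmax a (Rmin b t).

Definition extend (a b : R) (g g' : R -> R) (t : R) : R :=
  g (clamp a b t) + g' (clamp a b t) * (t - clamp a b t).

Lemma clamp_id (a b t : R) : a <= t <= b -> clamp a b t = t.
Proof. intros H. unfold clamp. rewrite Rmin_right, Rmax_right; lra. Qed.

Lemma extend_id (a b : R) (g g' : R -> R) (t : R) : a <= t <= b -> extend a b g g' t = g t.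
Proof. intros H. unfold extend. rewrite clamp_id by auto. ring. Qed.

(* Affine continuation outside [a, b] turns one-sided derivatives at the endpoints into
   two-sided ones. *)
Lemma extend_deriv (a b : R) (g g' : R -> R) (x : R) : a <= x <= b ->
  deriv_within a b g x (g' x) -> is_derive (extend a b g g') x (g' x).
Proof.
  intros Hx H. apply is_derive_Reals. intros eps He.
  destruct (H eps He) as [d [Hd H']].
  assert (Hd' : exists d', 0 < d' /\ d' <= d /\ (a < x -> d' <= x - a) /\ (x < b -> d' <= b - x)).
  { destruct (Rle_lt_dec x a), (Rle_lt_dec b x).
    - exists d. repeat split; lra.
    - exists (Rmin d (b - x)). repeat split; intros; try lra;
        [apply Rmin_pos; lra|apply Rmin_l|apply Rmin_r].
    - exists (Rmin d (x - a)). repeat split; intros; try lra;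
        [apply Rmin_pos; lra|apply Rmin_l|apply Rmin_r].
    - exists (Rmin d (Rmin (x - a) (b - x))). repeat split; intros.
      + repeat apply Rmin_pos; lra.
      + apply Rmin_l.
      + eapply Rle_trans; [apply Rmin_r|apply Rmin_l].
      + eapply Rle_trans; [apply Rmin_r|apply Rmin_r]. }
  destruct Hd' as [d' [Hd'0 [Hd'1 [Hd'2 Hd'3]]]].
  exists (mkposreal d' Hd'0). simpl. intros h Hh Hhd.
  rewrite (extend_id a b g g' x Hx).
  destruct (Rlt_le_dec (x + h) a) as [Ha|Ha]; [|destruct (Rlt_le_dec b (x + h)) as [Hb|Hb]].
  - assert (Ex : x = a).
    { destruct (Rle_lt_dec x a); [lra|]. apply Rabs_lt_between in Hhd. lra. }
    unfold extend, clamp. rewrite Rmin_right, Rmax_left by lra. subst x.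
    replace (_ / h - _) with 0 by (field; auto). now rewrite Rabs_R0.
  - assert (Ex : x = b).
    { destruct (Rle_lt_dec b x); [lra|]. apply Rabs_lt_between in Hhd. lra. }
    unfold extend, clamp. rewrite Rmin_left, Rmax_right by lra. subst x.
    replace (_ / h - _) with 0 by (field; auto). now rewrite Rabs_R0.
  - rewrite extend_id by lra.
    specialize (H' (x + h) (conj Ha Hb)). replace (x + h - x) with h in H' by ring.
    apply H'. split; [now apply Rabs_pos_lt|lra].
Qed.

Lemma deriv_within_sub_scal (a b : R) (f g : R -> R) (x l m c : R) :
  deriv_within a b f x l -> deriv_within a b g x m ->
  deriv_within a b (fun t => f t - c * g t) x (l - c * m).
Proof.
  intros Hf Hg eps He. pose proof (Rabs_pos c).
  destruct (Hf (eps / 2)) as [d1 [Hd1 H1]]; [lra|].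
  destruct (Hg (eps / 2 / (1 + Rabs c))) as [d2 [Hd2 H2]]; [apply Rdiv_lt_0_compat; lra|].
  exists (Rmin d1 d2). split; [now apply Rmin_pos|]. intros y Hy Hyd.
  specialize (H1 y Hy). specialize (H2 y Hy).
  pose proof (Rmin_l d1 d2). pose proof (Rmin_r d1 d2).
  specialize (H1 ltac:(lra)). specialize (H2 ltac:(lra)).
  assert (y - x <> 0) by (intros E; rewrite E, Rabs_R0 in Hyd; lra).
  replace (_ / (y - x) - _) with (((f y - f x) / (y - x) - l) - c * ((g y - g x) / (y - x) - m))
    by (field; auto).
  eapply Rle_lt_trans; [apply Rabs_triang|]. rewrite Rabs_Ropp, Rabs_mult.
  apply Rlt_div_r in H2; [|lra].
  pose proof (Rabs_pos ((g y - g x) / (y - x) - m)). nra.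
Qed.

Lemma Dseq_deriv_within (lam : nat -> R) (a b : R) (fd : nat -> R -> R) (n : nat) :
  smooth_seq_on a b fd -> smooth_seq_on a b (Dseq lam n fd).
Proof.
  intros H. induction n as [|n IHn]; [exact H|]. intros k x Hx. simpl.
  apply deriv_within_sub_scal; now apply IHn.
Qed.

(** Makes the operators usable with two-sided derivatives up to the endpoints. The derivative is the
    definition of [D^(n+1) f] solved for [(D^(n) f)']. *)
Lemma Dn_extension (lam : nat -> R) (a b : R) (fd : nat -> R -> R) : smooth_seq_on a b fd ->
  exists g : nat -> R -> R, forall n x, a <= x <= b ->
    g n x = Dn lam n fd x /\
    is_derive (g n) x (Dn lam (S n) fd x + lam n * Dn lam n fd x).
Proof.
  intros H. exists (fun n => extend a b (Dseq lam n fd 0) (Dseq lam n fd 1)).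
  intros n x Hx. split; [now apply extend_id|].
  replace (_ + _) with (Dseq lam n fd 1 x) by (unfold Dn; simpl; ring).
  apply extend_deriv; auto. now apply Dseq_deriv_within.
Qed.

(** Integrating factor: the weighted function has no zeroth order term in its derivative, so the
    mean value theorem sees [u] alone. *)
Lemma first_order_deriv_exp (l a t : R) (g : R -> R) (u : R) :
  is_derive g t (u + l * g t) ->
  is_derive (fun t => exp (- l * (t - a)) * g t) t (exp (- l * (t - a)) * u).
Proof.
  intros H.
  assert (DE : is_derive (fun t => exp (- l * (t - a))) t (- l * exp (- l * (t - a)))).
  { auto_derive; auto. unfold Rminus; ring. }
  replace (exp _ * u) with (- l * exp (- l * (t - a)) * g t
    + exp (- l * (t - a)) * (u + l * g t)) by ring.
  exact (is_derive_mult _ _ t _ _ DE H Rmult_comm).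
Qed.

(* A Landau-type inequality for second order operators with bounded coefficients. *)
Lemma middle_derivative_bound (g u v : R -> R) (l m a h K M V : R) : 0 < h ->
  Rabs l * h <= K -> Rabs m * h <= K ->
  (forall t, a <= t <= a + h -> is_derive g t (u t + l * g t)) ->
  (forall t, a <= t <= a + h -> is_derive u t (v t + m * u t)) ->
  (forall t, a <= t <= a + h -> Rabs (g t) <= M) ->
  (forall t, a <= t <= a + h -> Rabs (v t) <= V) ->
  Rabs (u a) <= 2 * exp (3 * K) * M / h + h * exp K * V.
Proof.
  intros Hh Hl Hm Dg Du HM HV.
  assert (B : forall c t, Rabs c * h <= K -> a <= t <= a + h -> exp (- c * (t - a)) <= exp K).
  { intros c t Hc Ht. apply exp_le_mono. pose proof (Rle_abs (- c)) as Q. rewrite Rabs_Ropp in Q.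
    pose proof (Rabs_pos c). nra. }
  assert (B' : forall c t, Rabs c * h <= K -> a <= t <= a + h -> exp (- K) <= exp (- c * (t - a))).
  { intros c t Hc Ht. apply exp_le_mono. pose proof (Rle_abs c) as Q.
    pose proof (Rabs_pos c). nra. }
  (* The total change of the weighted [g] over length [h] bounds [u] at some intermediate [xi], at
     the cost of a division by [h]. *)
  destruct (mean_value_derive _ _ a (a + h) ltac:(lra)
    (fun t Ht => first_order_deriv_exp l a t g (u t) (Dg t Ht))) as [xi [Hxi E]].
  (* The bound is carried from [xi] back to [a]; the change of the weighted [u] costs at most [h]
     times a bound for [v]. *)
  destruct (mean_value_derive _ _ a xi ltac:(lra)
    (fun t Ht => first_order_deriv_exp m a t u (v t) (Du t ltac:(lra)))) as [eta [Heta E']].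
  replace (a - a) with 0 in * by ring. rewrite Rmult_0_r, exp_0, Rmult_1_l in *.
  assert (EK : exp (- K) * exp K = 1) by (rewrite <- exp_plus, Rplus_opp_l; apply exp_0).
  assert (E3 : exp (3 * K) = exp K * exp K * exp K)
    by (rewrite <- !exp_plus; f_equal; ring).
  assert (HK : 1 <= exp K).
  { rewrite <- exp_0. apply exp_le_mono. pose proof (Rabs_pos l). nra. }
  assert (M0 : 0 <= M) by (eapply Rle_trans; [apply Rabs_pos|apply (HM a); lra]).
  assert (V0 : 0 <= V) by (eapply Rle_trans; [apply Rabs_pos|apply (HV a); lra]).
  assert (U1 : Rabs (u xi) <= 2 * (exp K * exp K) * M / h).
  { apply Rle_div_r; [lra|].
    assert (Q : exp (- K) * (Rabs (u xi) * h) <= 2 * exp K * M).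
    { apply Rle_trans with (Rabs (exp (- l * (a + h - a)) * g (a + h) - g a)).
      - rewrite E, !Rabs_mult, (Rabs_pos_eq (exp _)) by (left; apply exp_pos).
        replace (a + h - a) with h by ring. rewrite (Rabs_pos_eq h), Rmult_assoc by lra.
        apply Rmult_le_compat_r; [|now apply B'].
        apply Rmult_le_pos; [apply Rabs_pos|lra].
      - eapply Rle_trans; [apply Rabs_triang|].
        rewrite Rabs_Ropp, Rabs_mult, (Rabs_pos_eq (exp _)) by (left; apply exp_pos).
        specialize (B l (a + h) Hl ltac:(lra)).
        pose proof (HM a ltac:(lra)). pose proof (HM (a + h) ltac:(lra)).
        pose proof (Rabs_pos (g (a + h))). pose proof (exp_pos (- l * (a + h - a))).
        assert (exp (- l * (a + h - a)) * Rabs (g (a + h)) <= exp K * M)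
          by (apply Rmult_le_compat; lra).
        nra. }
    replace (Rabs (u xi) * h) with (exp K * (exp (- K) * (Rabs (u xi) * h)))
      by (transitivity ((exp (- K) * exp K) * (Rabs (u xi) * h)); [ring|rewrite EK; ring]).
    replace (2 * (exp K * exp K) * M) with (exp K * (2 * exp K * M)) by ring.
    apply Rmult_le_compat_l; lra. }
  replace (u a) with (exp (- m * (xi - a)) * u xi - exp (- m * (eta - a)) * v eta * (xi - a)) by lra.
  eapply Rle_trans; [apply Rabs_triang|].
  rewrite Rabs_Ropp, !Rabs_mult, !(Rabs_pos_eq (exp _)), (Rabs_pos_eq (xi - a))
    by (try (left; apply exp_pos); lra).
  apply Rplus_le_compat.
  (* Of the three factors [exp K], two come from the weight in the bound at [xi] (in the endpoint
     values and in the derivative) and one from the weight of [u xi]. *)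
  - replace (2 * exp (3 * K) * M / h) with (exp K * (2 * (exp K * exp K) * M / h))
      by (rewrite E3; field; lra).
    apply Rmult_le_compat; auto using Rabs_pos; left; apply exp_pos.
  - replace (h * exp K * V) with (exp K * V * h) by ring.
    pose proof (exp_pos (- m * (eta - a))).
    apply Rmult_le_compat; try lra.
    + apply Rmult_le_pos; [lra|apply Rabs_pos].
    + apply Rmult_le_compat; try lra; [apply Rabs_pos|apply B; auto; lra|apply HV; lra].
Qed.

(** Taking [eps = b - beta] gives [|lam_n| <= b n] beyond some [N]; the finitely many earlier terms
    go into [A]. *)
Lemma linear_growth_of_limsup (lam : nat -> R) (beta b : R) : beta < b ->
  (forall eps, 0 < eps -> exists N : nat, forall n : nat,
      (N <= n)%nat -> Rabs (lam n) / INR n <= beta + eps) ->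
  exists A, 0 <= A /\ forall n, Rabs (lam n) <= A + b * INR n.
Proof.
  intros Hb H. destruct (H (b - beta)) as [N HN]; [lra|].
  set (m := maxabs lam N). assert (Hm : 0 <= m) by apply maxabs_ge_0.
  (* The summand [Rabs b * INR N] offsets [b * INR n] for [n <= N] in case [b] is negative. *)
  exists (m + Rabs b * INR N). pose proof (Rabs_pos b). pose proof (pos_INR N).
  split; [nra|]. intros n. destruct (Nat.le_gt_cases n N) as [Hn|Hn].
  - pose proof (Rabs_le_maxabs lam N n Hn). fold m in H2. pose proof (le_INR _ _ Hn).
    pose proof (Rle_abs (- b)) as Q. rewrite Rabs_Ropp in Q. pose proof (pos_INR n). nra.
  - specialize (HN n ltac:(lia)). assert (0 < INR n) by (apply lt_0_INR; lia).
    apply Rle_div_l in HN; [|lra]. replace (beta + (b - beta)) with b in HN by ring. nra.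
Qed.

(** For order [2m+1] the Landau inequality is used on length [h = gamma / (m+1)]. The term [M / h]
    is controlled by [(m+1) (2m)! <= (2m+1)!], and [h V] by [(2m+2)! / (m+1) = 2 (2m+1)!]; the spare
    powers of [sigma] and [gamma] enter the constant only. *)
Lemma Dn_bound_at_left (lam : nat -> R) (A b x0 gamma Cst sigma : R) (fd : nat -> R -> R) :
  0 <= A -> 0 < b -> (forall n, Rabs (lam n) <= A + b * INR n) ->
  0 < gamma -> smooth_seq_on x0 (x0 + gamma) fd -> 0 < Cst -> 0 < sigma ->
  (forall (n : nat) t, x0 <= t <= x0 + gamma ->
      Rabs (Dn lam (2 * n) fd t) <= Cst * INR (fact (2 * n)) * sigma ^ (2 * n)) ->
  exists C', 0 < C' /\ forall n, Rabs (Dn lam n fd x0) <= C' * (INR (fact n) * sigma ^ n).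
Proof.
  intros HA Hb Hlam Hg Hs HC Hsig HD.
  (* For [j <= 2m+1], [|lam_j| <= A + b (2m+1) <= (A + 2b)(m+1)], so [|lam_j| h <= K] uniformly in
     [m]. *)
  set (K := (A + 2 * b) * gamma).
  (* [k1] and [k2] are the two Landau terms relative to [Cst (2m+1)! sigma^(2m+1)], as [B1] and [B2]
     verify. *)
  set (k1 := 2 * exp (3 * K) / (gamma * sigma)). set (k2 := 2 * gamma * exp K * sigma).
  assert (Hk1 : 0 < k1).
  { unfold k1. pose proof (exp_pos (3 * K)). apply Rdiv_lt_0_compat; nra. }
  assert (Hk2 : 0 < k2).
  { unfold k2. pose proof (exp_pos K). repeat apply Rmult_lt_0_compat; lra. }
  assert (Hpos : forall n, 0 < INR (fact n) * sigma ^ n)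
    by (intros; apply Rmult_lt_0_compat; [apply INR_fact_lt_0|now apply pow_lt]).
  exists (Cst * (1 + (k1 + k2))). split; [apply Rmult_lt_0_compat; lra|].
  intros n. destruct (Nat.Even_or_Odd n) as [[m Hm]|[m Hm]].
  - rewrite Hm. eapply Rle_trans; [apply HD; lra|].
    specialize (Hpos (2 * m)%nat). rewrite !Rmult_assoc.
    apply Rmult_le_compat_l; [lra|]. nra.
  - destruct (Dn_extension lam x0 (x0 + gamma) fd Hs) as [g Hgx].
    assert (Hm1 : 0 < INR (S m)) by (apply lt_0_INR; lia).
    pose proof (pos_INR m) as Hm0.
    set (h := gamma / INR (S m)).
    assert (Hh : 0 < h) by now apply Rdiv_lt_0_compat.
    assert (Hhg : h <= gamma).
    { apply Rle_div_l; auto. rewrite S_INR. nra. }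
    assert (HK : forall j, (j <= 2 * m + 1)%nat -> Rabs (lam j) * h <= K).
    { intros j Hj. apply le_INR in Hj. rewrite plus_INR, mult_INR in Hj. simpl INR in Hj.
      specialize (Hlam j). unfold h, K.
      replace (Rabs (lam j) * (gamma / INR (S m))) with (Rabs (lam j) * gamma / INR (S m))
        by (field; lra).
      apply Rle_div_l; auto. rewrite S_INR.
      replace ((A + 2 * b) * gamma * (INR m + 1)) with (((A + 2 * b) * (INR m + 1)) * gamma) by ring.
      apply Rmult_le_compat_r; [lra|]. nra. }
    assert (Hin : forall t, x0 <= t <= x0 + h -> x0 <= t <= x0 + gamma) by (intros; lra).
    set (V := Cst * INR (fact (2 * m + 2)) * sigma ^ (2 * m + 2)).
    set (M := Cst * INR (fact (2 * m)) * sigma ^ (2 * m)).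
    pose proof (middle_derivative_bound (g (2 * m)%nat) (g (2 * m + 1)%nat)
      (Dn lam (2 * m + 2) fd) (lam (2 * m)%nat) (lam (2 * m + 1)%nat) x0 h K M V Hh
      (HK (2 * m)%nat ltac:(lia)) (HK (2 * m + 1)%nat ltac:(lia))) as P.
    assert (Q : Rabs (g (2 * m + 1)%nat x0) <= 2 * exp (3 * K) * M / h + h * exp K * V).
    { apply P; intros t Ht; specialize (Hin t Ht).
      - destruct (Hgx (2 * m)%nat t Hin) as [E1 D1].
        destruct (Hgx (2 * m + 1)%nat t Hin) as [E2 _].
        rewrite E1, E2. replace (2 * m + 1)%nat with (S (2 * m)) by lia. exact D1.
      - destruct (Hgx (2 * m + 1)%nat t Hin) as [E2 D2].
        rewrite E2. replace (2 * m + 2)%nat with (S (2 * m + 1)) by lia. exact D2.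
      - destruct (Hgx (2 * m)%nat t Hin) as [E1 _]. rewrite E1. now apply HD.
      - unfold V. replace (2 * m + 2)%nat with (2 * (m + 1))%nat by lia. now apply HD. }
    rewrite (proj1 (Hgx (2 * m + 1)%nat x0 ltac:(lra))) in Q. rewrite Hm.
    eapply Rle_trans; [exact Q|].
    set (T := INR (fact (2 * m + 1)) * sigma ^ (2 * m + 1)).
    assert (HT : 0 < T) by apply Hpos.
    assert (Fv : INR (fact (2 * m + 2)) = 2 * INR (S m) * INR (fact (2 * m + 1))).
    { replace (2 * m + 2)%nat with (S (2 * m + 1)) by lia.
      rewrite fact_simpl, mult_INR. f_equal.
      replace (S (2 * m + 1)) with (2 * S m)%nat by lia. rewrite mult_INR. reflexivity. }
    assert (Fu : INR (fact (2 * m + 1)) = (2 * INR m + 1) * INR (fact (2 * m))).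
    { replace (2 * m + 1)%nat with (S (2 * m)) by lia.
      rewrite fact_simpl, mult_INR. f_equal. rewrite S_INR, mult_INR. simpl. ring. }
    assert (B1 : 2 * exp (3 * K) * M / h <= Cst * k1 * T).
    { assert (EM : 2 * exp (3 * K) * M / h =
        Cst * k1 * (INR (S m) * (INR (fact (2 * m)) * sigma ^ (2 * m + 1)))).
      { unfold M, h, k1. rewrite pow_add. simpl (sigma ^ 1). field. repeat split; lra. }
      rewrite EM. apply Rmult_le_compat_l; [nra|]. unfold T. rewrite Fu, S_INR.
      rewrite <- Rmult_assoc. apply Rmult_le_compat_r; [left; now apply pow_lt|].
      apply Rmult_le_compat_r; [left; apply INR_fact_lt_0|]. lra. }
    assert (B2 : h * exp K * V = Cst * k2 * T).
    { unfold h, V, k2, T. rewrite Fv. replace (2 * m + 2)%nat with (2 * m + 1 + 1)%nat by lia.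
      rewrite (pow_add sigma (2 * m + 1) 1). simpl (sigma ^ 1). field. lra. }
    rewrite B2. nra.
Qed.

(** * Dominated series of complex functions *)

Fixpoint Csum (U : nat -> C) (N : nat) : C :=
  match N with O => Complex.RtoC 0 | S m => (Csum U m + U m)%C end.

(** A total function built from [Series]; its value is meaningful when both coordinate series
    converge, which domination always ensures below. *)
Definition CSeries (U : nat -> C) : C :=
  (Series (fun n => fst (U n)), Series (fun n => snd (U n))).

Definition tail (M : nat -> R) (N : nat) : R := Series (fun k => M (N + k)%nat).

Lemma ex_series_tail (M : nat -> R) (N : nat) : ex_series M -> ex_series (fun k => M (N + k)%nat).
Proof. intros H. now apply (ex_series_incr_n (V:=R_NormedModule)). Qed.

Lemma tail_S (M : nat -> R) (N : nat) : ex_series M -> tail M N = M N + tail M (S N).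
Proof.
  intros H. unfold tail. rewrite Series_incr_1 by now apply ex_series_tail.
  rewrite Nat.add_0_r. f_equal. apply Series_ext. intros k. f_equal. lia.
Qed.

Lemma tail_ge_0 (M : nat -> R) (N : nat) : (forall n, 0 <= M n) -> ex_series M -> 0 <= tail M N.
Proof.
  intros HM H. eapply Rle_trans; [apply Rabs_pos|].
  assert (E : forall k, Rabs (M (N + k)%nat) = M (N + k)%nat) by (intros; now apply Rabs_pos_eq).
  unfold tail. rewrite <- (Series_ext _ _ E). apply Series_Rabs.
  apply (ex_series_ext (V:=R_NormedModule) (fun k => M (N + k)%nat)); [easy|].
  now apply ex_series_tail.
Qed.

Lemma tail_small (M : nat -> R) (eps : R) : (forall n, 0 <= M n) -> ex_series M -> 0 < eps ->
  exists N0, forall N, (N0 <= N)%nat -> tail M N < eps.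
Proof.
  intros HM H He.
  assert (L := Series_correct M H). apply is_series_Reals in L.
  (* [sum_f_R0 M n] has [n + 1] terms, so its complement is the tail from [S n]; hence the witness
     [S N0]. *)
  destruct (L eps He) as [N0 HN0]. exists (S N0). intros N HN.
  assert (E : forall n, sum_f_R0 M n + tail M (S n) = tail M 0).
  { induction n; simpl sum_f_R0.
    - now rewrite <- (tail_S M 0).
    - rewrite <- IHn, (tail_S M (S n)) by auto. ring. }
  destruct N as [|n]; [lia|]. specialize (HN0 n ltac:(lia)).
  unfold Rdist in HN0. change (Series M) with (tail M 0) in HN0.
  specialize (E n). rewrite Rabs_minus_sym in HN0.
  replace (tail M 0 - sum_f_R0 M n) with (tail M (S n)) in HN0 by lra.
  eapply Rle_lt_trans; [apply Rle_abs|exact HN0].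
Qed.

Lemma Rsum_tail_le (a M : nat -> R) (N : nat) : (forall n, Rabs (a n) <= M n) -> ex_series M ->
  Rabs (tail a N) <= tail M N.
Proof.
  intros Ha H. assert (HM := ex_series_tail M N H).
  assert (Habs : ex_series (fun k => Rabs (a (N + k)%nat))).
  { apply (ex_series_le (K:=R_AbsRing) (V:=R_CompleteNormedModule) _ (fun k => M (N + k)%nat)); auto.
    intros k. unfold norm; simpl; unfold abs; simpl. rewrite Rabs_Rabsolu. apply Ha. }
  eapply Rle_trans; [now apply Series_Rabs|]. apply Series_le; auto.
  intros k; split; [apply Rabs_pos|apply Ha].
Qed.

Lemma ex_series_dominated (a M : nat -> R) : (forall n, Rabs (a n) <= M n) -> ex_series M ->
  ex_series a.
Proof.
  intros Ha H. apply (ex_series_le (K:=R_AbsRing) (V:=R_CompleteNormedModule) _ M); auto.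
Qed.

Lemma Csum_sub_CSeries_le (U : nat -> C) (M : nat -> R) (N : nat) :
  (forall n, Cmod (U n) <= M n) -> ex_series M ->
  Cmod (Csum U N - CSeries U)%C <= 2 * tail M N.
Proof.
  intros HU H.
  assert (H1 : forall n, Rabs (fst (U n)) <= M n)
    by (intros; eapply Rle_trans; [apply fst_le_Cmod|apply HU]).
  assert (H2 : forall n, Rabs (snd (U n)) <= M n)
    by (intros; eapply Rle_trans; [apply snd_le_Cmod|apply HU]).
  assert (E : (Csum U N - CSeries U)%C =
    (- (tail (fun n => fst (U n)) N, tail (fun n => snd (U n)) N))%C).
  { induction N as [|N IHN]; simpl Csum.
    - unfold Cminus. rewrite Cplus_0_l. reflexivity.
    - replace (Csum U N + U N - CSeries U)%C with ((Csum U N - CSeries U) + U N)%C by ring.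
      rewrite IHN, (tail_S (fun n => fst (U n)) N), (tail_S (fun n => snd (U n)) N)
        by (eapply ex_series_dominated; eauto).
      destruct (U N) as [p q]. unfold Cplus, Complex.Copp; simpl.
      f_equal; ring. }
  rewrite E, Cmod_opp. apply Cmod_le_fst_snd; simpl; now apply Rsum_tail_le.
Qed.

Lemma CSeries_lin (U V : nat -> C) (M : nat -> R) (c : C) :
  (forall n, Cmod (U n) <= M n) -> (forall n, Cmod (V n) <= M n) -> ex_series M ->
  CSeries (fun n => U n + c * V n)%C = (CSeries U + c * CSeries V)%C.
Proof.
  intros HU HV H.
  assert (U1 : ex_series (fun n => fst (U n))) by (apply (ex_series_dominated _ M); auto;
    intros; eapply Rle_trans; [apply fst_le_Cmod|apply HU]).
  assert (U2 : ex_series (fun n => snd (U n))) by (apply (ex_series_dominated _ M); auto;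
    intros; eapply Rle_trans; [apply snd_le_Cmod|apply HU]).
  assert (V1 : ex_series (fun n => fst (V n))) by (apply (ex_series_dominated _ M); auto;
    intros; eapply Rle_trans; [apply fst_le_Cmod|apply HV]).
  assert (V2 : ex_series (fun n => snd (V n))) by (apply (ex_series_dominated _ M); auto;
    intros; eapply Rle_trans; [apply snd_le_Cmod|apply HV]).
  assert (L : forall (p q r : nat -> R) (a b : R), ex_series p -> ex_series q -> ex_series r ->
    Series (fun n => p n + (a * q n + b * r n)) = Series p + (a * Series q + b * Series r)).
  { intros p q r a b Hp Hq Hr.
    assert (Hq' := ex_series_scal (V:=R_NormedModule) a q Hq).
    assert (Hr' := ex_series_scal (V:=R_NormedModule) b r Hr).
    rewrite Series_plus; auto.
    - rewrite (Series_plus (fun n => a * q n)) by auto. now rewrite !Series_scal_l.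
    - now apply (ex_series_plus (V:=R_NormedModule) (fun n => a * q n)). }
  unfold CSeries, Cplus, Cmult; simpl. f_equal.
  - rewrite (Series_ext _ (fun n => fst (U n) + (fst c * fst (V n) + (- snd c) * snd (V n))))
      by (intros; ring).
    rewrite L by assumption. ring.
  - rewrite L by assumption. reflexivity.
Qed.

Lemma Csum_deriv (U U' : nat -> C -> C) (z : C) (N : nat) :
  (forall n, complex_deriv (U n) z (U' n z)) ->
  complex_deriv (fun z => Csum (fun n => U n z) N) z (Csum (fun n => U' n z) N).
Proof.
  intros H. induction N as [|N IHN]; simpl.
  - intros eps He. exists 1. split; [lra|]. intros h _.
    replace (_ - _ - _)%C with (Complex.RtoC 0) by ring. rewrite Cmod_0.
    pose proof (Cmod_ge_0 h). nra.
  - apply (complex_deriv_ext (fun z => Csum (fun n => U n z) N + 1 * U N z)%C); [intros; ring|].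
    replace (Csum _ N + U' N z)%C with (Csum (fun n => U' n z) N + 1 * U' N z)%C by ring.
    now apply complex_deriv_lin.
Qed.

Lemma Csum_ext (U V : nat -> C) (N : nat) : (forall n, U n = V n) -> Csum U N = Csum V N.
Proof. intros E. induction N; simpl; congruence. Qed.

Lemma Csum_lin (U V : nat -> C) (c : C) (N : nat) :
  Csum (fun n => U n + c * V n)%C N = (Csum U N + c * Csum V N)%C.
Proof. induction N; simpl; [|rewrite IHN]; ring. Qed.

(** The first order error of term [n] is at most [2 M_n |h|], by the mean value inequality and the
    bound on [U']. The tail of the errors is therefore small relative to [|h|] uniformly in [h], and
    the finite head is differentiated directly. *)
Lemma CSeries_deriv (U U' : nat -> C -> C) (M : nat -> R) (r : R) (z : C) : Cmod z < r ->
  (forall n z, Cmod z <= r -> complex_deriv (U n) z (U' n z)) ->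
  (forall n z, Cmod z <= r -> Cmod (U n z) <= M n) ->
  (forall n z, Cmod z <= r -> Cmod (U' n z) <= M n) ->
  ex_series M ->
  complex_deriv (fun z => CSeries (fun n => U n z)) z (CSeries (fun n => U' n z)).
Proof.
  intros Hz HD HU HU' HM eps He.
  assert (M0 : forall n, 0 <= M n)
    by (intros n; eapply Rle_trans; [apply Cmod_ge_0|apply (HU n z); lra]).
  (* The tail enters with factor 4, namely 2 from each error and 2 from passing to coordinates, so
     [eps / 8] uses half of [eps]. *)
  destruct (tail_small M (eps / 8) M0 HM) as [N HN]; [lra|].
  specialize (HN N (le_n N)).
  destruct (Csum_deriv U U' z N (fun n => HD n z (Rlt_le _ _ Hz)) (eps / 2)) as [d [Hd H']]; [lra|].
  (* The second bound keeps the whole segment from [z] to [z + h] in the disc where the estimates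
     hold. *)
  exists (Rmin d (r - Cmod z)). split; [apply Rmin_pos; lra|]. intros h Hh.
  specialize (H' h (Rlt_le_trans _ _ _ Hh (Rmin_l _ _))).
  assert (Hhr := Rlt_le_trans _ _ _ Hh (Rmin_r _ _)).
  pose proof (Cmod_ge_0 h) as Hh0.
  assert (Hseg : forall t, 0 <= t <= 1 -> Cmod (z + t * h)%C <= r).
  { intros t Ht. eapply Rle_trans; [apply Cmod_triangle|].
    rewrite Cmod_mult, Cmod_R, Rabs_pos_eq by lra. nra. }
  assert (Hzh : Cmod (z + h)%C <= r).
  { replace (z + h)%C with (z + 1 * h)%C by ring. apply Hseg; lra. }
  set (V := fun n => (U n (z + h)%C + (- (1)) * U n z + (- h) * U' n z)%C).
  assert (HV : forall n, Cmod (V n) <= (2 * Cmod h) * M n).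
  { intros n. unfold V.
    replace (U n (z + h)%C + - (1) * U n z + - h * U' n z)%C with
      ((U n (z + h)%C - U n z) + (- h) * U' n z)%C by ring.
    eapply Rle_trans; [apply Cmod_triangle|]. rewrite Cmod_mult, Cmod_opp.
    assert (Cmod (U n (z + h) - U n z)%C <= M n * Cmod h)
      by (apply (Cmod_increment_le (U n) (U' n)); auto).
    specialize (HU' n z ltac:(lra)). nra. }
  assert (HMh : ex_series (fun n => (2 * Cmod h) * M n))
    by now apply (ex_series_scal (V:=R_NormedModule)).
  assert (EV : CSeries V = (CSeries (fun n => U n (z + h)) - CSeries (fun n => U n z)
      - CSeries (fun n => U' n z) * h)%C).
  { assert (HM2 : ex_series (fun n => 2 * M n))
      by now apply (ex_series_scal (V:=R_NormedModule)).
    unfold V. rewrite (CSeries_lin (fun n => U n (z + h)%C + (- (1)) * U n z)%C _ (fun n => 2 * M n)); auto.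
    - rewrite (CSeries_lin _ _ M); auto; [ring|]. intros; apply HU; lra.
    - intros n. eapply Rle_trans; [apply Cmod_triangle|]. rewrite Cmod_mult, Cmod_m1.
      pose proof (HU n (z + h)%C Hzh). pose proof (HU n z ltac:(lra)). lra.
    - intros n. pose proof (HU' n z ltac:(lra)). specialize (M0 n). lra. }
  assert (EVN : Csum V N = (Csum (fun n => U n (z + h)) N - Csum (fun n => U n z) N
      - Csum (fun n => U' n z) N * h)%C).
  { unfold V. rewrite (Csum_lin (fun n => U n (z + h)%C + (- (1)) * U n z)%C), Csum_lin. ring. }
  rewrite <- EV. rewrite <- EVN in H'.
  pose proof (Csum_sub_CSeries_le V _ N HV HMh) as T.
  assert (ET : tail (fun n => 2 * Cmod h * M n) N = 2 * Cmod h * tail M N)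
    by (unfold tail; apply Series_scal_l).
  rewrite ET in T. rewrite Cmod_sub_comm in T.
  pose proof (Cmod_triangle_rev (CSeries V) (Csum V N)). nra.
Qed.

(** * Convergence of the expansion and its remainder *)

(** The condition on [r] says [beta - sigma (e^(beta r) - 1) > 0]; this expression is continuous in
    [beta], so it stays positive for some larger [b]. *)
Lemma exists_growth_rate (beta sigma r : R) : 0 < beta -> 0 < sigma ->
  r < ln (1 + beta / sigma) / beta ->
  exists b, beta < b /\ sigma * ((exp (b * r) - 1) / b) < 1.
Proof.
  intros Hb Hs Hr. apply Rlt_div_r in Hr; auto.
  assert (Hbs : 0 < beta / sigma) by now apply Rdiv_lt_0_compat.
  apply exp_increasing in Hr. rewrite exp_ln in Hr by lra.
  set (phi := fun b => b - sigma * (exp (b * r) - 1)).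
  assert (Hphi : 0 < phi beta).
  { unfold phi. assert (sigma * (exp (beta * r) - 1) < sigma * (beta / sigma)).
    { apply Rmult_lt_compat_l; auto. rewrite Rmult_comm. lra. }
    replace (sigma * (beta / sigma)) with beta in H by (field; lra). lra. }
  assert (Hc : continuous phi beta).
  { apply (ex_derive_continuous phi). unfold phi. auto_derive. auto. }
  destruct (Hc _ (open_gt 0 (phi beta) Hphi)) as [d Hd].
  exists (beta + d / 2). pose proof (cond_pos d). split; [lra|].
  assert (Q : 0 < phi (beta + d / 2)).
  { apply Hd. apply Rabs_lt_between'. simpl. lra. }
  unfold phi in Q.
  replace (sigma * ((exp ((beta + d / 2) * r) - 1) / (beta + d / 2))) with
    (sigma * (exp ((beta + d / 2) * r) - 1) / (beta + d / 2)) by (field; lra).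
  apply Rlt_div_l; lra.
Qed.

(** [n! sigma^n] is the size of [D^(n) f(x0)]; its factorial cancels the one in [Phi_bound] and
    leaves [q^n]. In the derivative the lower order [Phi_(n-1)] and the factor [lam_n] each cost a
    factor linear in [n]. *)
Lemma Phi_factorial_bounds (lam : nat -> R) (A b sigma r : R) :
  0 <= A -> 0 < b -> (forall n, Rabs (lam n) <= A + b * INR n) ->
  0 < sigma -> 0 < r -> sigma * ((exp (b * r) - 1) / b) < 1 ->
  exists K q, 0 < K /\ 0 < q < 1 /\ forall n z, Cmod z <= r ->
    INR (fact n) * sigma ^ n * Cmod (Phi lam n z) <= K * q ^ n /\
    INR (fact n) * sigma ^ n * Cmod (Phi' lam n z) <= K * (INR (S n) * q ^ n).
Proof.
  intros HA Hb Hlam Hs Hr Hq1.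
  set (q := sigma * ((exp (b * r) - 1) / b)) in *.
  assert (Hq0 : 0 < q).
  { unfold q. apply Rmult_lt_0_compat; auto. apply Rdiv_lt_0_compat; auto.
    assert (exp 0 < exp (b * r)) by (apply exp_increasing; nra). rewrite exp_0 in *. lra. }
  set (E := exp (A * r)). assert (HE : 0 < E) by apply exp_pos.
  assert (Hsq : 0 < sigma / q) by now apply Rdiv_lt_0_compat.
  (* [A + b] accounts for [lam_n], and [sigma / q] for the shift from [q^(n-1)] to [q^n] in the
     lower order term. *)
  exists (E * (1 + (A + b + sigma / q))), q.
  split; [apply Rmult_lt_0_compat; lra|]. split; [auto|]. intros n z Hz.
  assert (W : forall m, INR (fact m) * sigma ^ m * Cmod (Phi lam m z) <= E * q ^ m).
  { intros m. pose proof (Phi_le lam A b Hb Hlam m z) as P. unfold Phi_bound in P.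
    set (s := Cmod z) in *. assert (Hs0 : 0 <= s) by apply Cmod_ge_0.
    pose proof (INR_fact_lt_0 m). pose proof (pow_lt sigma m Hs).
    apply Rle_trans with (INR (fact m) * sigma ^ m *
      (exp (A * s) * ((exp (b * s) - 1) / b) ^ m / INR (fact m))).
    - apply Rmult_le_compat_l; [nra|exact P].
    - replace (INR (fact m) * sigma ^ m * (exp (A * s) * ((exp (b * s) - 1) / b) ^ m / INR (fact m)))
        with (exp (A * s) * (sigma * ((exp (b * s) - 1) / b)) ^ m)
        by (rewrite Rpow_mult_distr; field; lra).
      assert (0 <= (exp (b * s) - 1) / b).
      { apply Rdiv_le_0_compat; auto. assert (exp 0 <= exp (b * s)) by (apply exp_le_mono; nra).
        rewrite exp_0 in *. lra. }
      assert (0 <= sigma * ((exp (b * s) - 1) / b)) by (apply Rmult_le_pos; lra).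
      apply Rmult_le_compat; [left; apply exp_pos|now apply pow_le|apply exp_le_mono; nra|].
      apply pow_incr. split; [assumption|]. unfold q. apply Rmult_le_compat_l; [lra|].
      apply Rmult_le_compat_r; [left; now apply Rinv_0_lt_compat|].
      assert (exp (b * s) <= exp (b * r)) by (apply exp_le_mono; nra). lra. }
  pose proof (pow_lt q n Hq0) as Hqn. pose proof (pos_INR n) as Hn.
  split.
  - eapply Rle_trans; [apply W|]. rewrite Rmult_assoc. apply Rmult_le_compat_l; [lra|].
    assert (0 <= (A + b + sigma / q) * q ^ n) by (apply Rmult_le_pos; lra). lra.
  - assert (Wp : INR (fact n) * sigma ^ n * Cmod (Phi_prev lam n z)
      <= E * (sigma / q) * (INR n * q ^ n)).
    { destruct n as [|m]; simpl Phi_prev.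
      - rewrite Cmod_0. simpl. lra.
      - rewrite fact_simpl, mult_INR.
        replace (INR (S m) * INR (fact m) * sigma ^ S m * Cmod (Phi lam m z)) with
          (INR (S m) * sigma * (INR (fact m) * sigma ^ m * Cmod (Phi lam m z))) by (simpl; ring).
        replace (E * (sigma / q) * (INR (S m) * q ^ S m)) with (INR (S m) * sigma * (E * q ^ m))
          by (simpl pow; field; lra).
        apply Rmult_le_compat_l; [nra|apply W]. }
    pose proof (Cmod_triangle (Phi_prev lam n z) (lam n * Phi lam n z)) as T.
    rewrite Cmod_mult, Cmod_R in T.
    specialize (W n). specialize (Hlam n).
    set (F := INR (fact n) * sigma ^ n) in *.
    assert (HF : 0 < F) by (apply Rmult_lt_0_compat; [apply INR_fact_lt_0|now apply pow_lt]).
    set (p1 := Cmod (Phi lam n z)) in *. assert (Hp1 : 0 <= p1) by apply Cmod_ge_0.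
    set (p2 := Cmod (Phi_prev lam n z)) in *.
    assert (X1 : F * (Rabs (lam n) * p1) <= (A + b * INR n) * (E * q ^ n)).
    { replace (F * (Rabs (lam n) * p1)) with (Rabs (lam n) * (F * p1)) by ring.
      apply Rmult_le_compat; auto using Rabs_pos. nra. }
    unfold Phi'. apply Rle_trans with (F * (p2 + Rabs (lam n) * p1)); [now apply Rmult_le_compat_l; lra|].
    rewrite Rmult_plus_distr_l.
    apply Rle_trans with (E * (sigma / q) * (INR n * q ^ n) + (A + b * INR n) * (E * q ^ n)); [lra|].
    rewrite S_INR.
    replace (_ + _) with ((E * q ^ n) * ((sigma / q) * INR n + (A + b * INR n))) by ring.
    replace (E * (1 + (A + b + sigma / q)) * ((INR n + 1) * q ^ n)) with
      ((E * q ^ n) * ((1 + (A + b + sigma / q)) * (INR n + 1))) by ring.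
    apply Rmult_le_compat_l; [nra|].
    assert (0 <= A * INR n) by (apply Rmult_le_pos; lra). nra.
Qed.

Lemma ex_series_arith_geom (q : R) : 0 < q < 1 -> ex_series (fun n => INR (S n) * q ^ n).
Proof.
  intros Hq.
  apply (ex_series_ext (V:=R_NormedModule) (fun n => Rabs (INR (S n) * q ^ n))).
  { intros n. apply Rabs_pos_eq. apply Rmult_le_pos; [apply pos_INR|apply pow_le; lra]. }
  apply ex_series_DAlembert with q; [lra| |].
  - intros n. apply Rgt_not_eq, Rmult_lt_0_compat; [apply lt_0_INR; lia|apply pow_lt; lra].
  (* The quotient of consecutive terms is [q (n+2) / (n+1)]. *)
  - apply is_lim_seq_ext with (fun n => q + q * / INR (S n)).
    + intros n. assert (0 < INR (S n)) by (apply lt_0_INR; lia).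
      assert (0 < q ^ n) by (apply pow_lt; lra).
      replace (INR (S (S n)) * q ^ S n / (INR (S n) * q ^ n)) with (q + q * / INR (S n))
        by (rewrite (S_INR (S n)); simpl pow; field; split; lra).
      symmetry. apply Rabs_pos_eq. pose proof (Rinv_0_lt_compat _ H). nra.
    + replace (Finite q) with (Finite (q + q * 0)) by (f_equal; ring).
      apply (is_lim_seq_plus' _ _ q (q * 0)); [apply is_lim_seq_const|].
      apply (is_lim_seq_scal_l _ q (Finite 0)).
      apply (is_lim_seq_incr_1 (fun n => / INR n)).
      replace (Finite 0) with (Rbar_inv p_infty) by reflexivity.
      apply is_lim_seq_inv; [apply is_lim_seq_INR|easy].
Qed.

(** * Partial sums and the moving base point *)

Lemma term_scal (lam : nat -> R) (fd : nat -> R -> R) (x0 : R) (n : nat) (z : C) :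
  term lam fd x0 n z = (Dn lam n fd x0 * Phi lam n (z - x0))%C.
Proof.
  unfold term, Cscal. change (Csub z (RtoC x0)) with (z - x0)%C.
  unfold Cmult; simpl. f_equal; ring.
Qed.

Lemma psum_Csum (lam : nat -> R) (fd : nat -> R -> R) (x0 : R) (N : nat) (z : C) :
  psum lam fd x0 N z = Csum (fun n => term lam fd x0 n z) N.
Proof. induction N as [|N IHN]; simpl; [reflexivity|now rewrite IHN]. Qed.

Lemma abs_block_le_tail (lam : nat -> R) (fd : nat -> R -> R) (x0 : R) (M : nat -> R)
  (N m : nat) (z : C) : ex_series M ->
  (forall n, 0 <= M n) -> (forall n, Cmod (term lam fd x0 n z) <= M n) ->
  abs_block lam fd x0 N m z <= tail M N.
Proof.
  intros HM M0 H.
  (* A block with parameter [m] has [m + 1] terms; keeping the remaining tail on the left makes the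
     induction close. *)
  assert (P : abs_block lam fd x0 N m z + tail M (N + S m) <= tail M N).
  { induction m as [|m IHm].
    - simpl abs_block. rewrite Cnorm_Cmod, (tail_S M N) by auto.
      replace (N + 1)%nat with (S N) by lia. pose proof (H N). lra.
    - simpl abs_block. rewrite Cnorm_Cmod. rewrite (tail_S M (N + S m)) in IHm by auto.
      replace (N + S (S m))%nat with (S (N + S m)) by lia. pose proof (H (N + S m)%nat). lra. }
  pose proof (tail_ge_0 M (N + S m) M0 HM). lra.
Qed.

(* Moving the base point t of the expansion from x0 to x: the derivatives of the terms
   telescope. *)
Lemma expansion_base_point_deriv (lam : nat -> R) (fd g : nat -> R -> R) (x t : R) :
  (forall n, g n t = Dn lam n fd t /\
    is_derive (g n) t (Dn lam (S n) fd t + lam n * Dn lam n fd t)) ->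
  forall N, curve_deriv (fun s => Csum (fun n => g n s * Phi lam n (x + s * (- (1))))%C N) t
    (Dn lam N fd t * Phi_prev lam N (x + t * (- (1))))%C.
Proof.
  intros H N. induction N as [|N IHN]; simpl Csum.
  - eapply curve_deriv_val; [apply curve_deriv_const|]. simpl Phi_prev. ring.
  - destruct (H N) as [E D].
    eapply curve_deriv_val.
    + apply curve_deriv_add; [exact IHN|].
      apply (curve_deriv_mul (fun s => Complex.RtoC (g N s))).
      * instantiate (1 := Complex.RtoC (Dn lam (S N) fd t + lam N * Dn lam N fd t)).
        split; [exact D|]. simpl. apply @is_derive_const.
      * apply complex_deriv_line, Phi_deriv.
    (* The new summand contributes [D^(N+1) f Phi_N - D^(N) f Phi_(N-1)], since the [lam_N] terms
       cancel; its second part cancels the induction hypothesis. *)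
    + rewrite E. unfold Phi'. simpl Phi_prev. rewrite RtoC_plus, RtoC_mult. ring.
Qed.

(** [Phi_n(0)] vanishes for [n > 0], so only the summand of index 0 survives; the length [S N]
    guarantees its presence. *)
Lemma Csum_at_base_point (lam : nat -> R) (a : nat -> R) (N : nat) :
  Csum (fun n => a n * Phi lam n (Complex.RtoC 0))%C (S N) = Complex.RtoC (a O).
Proof.
  induction N as [|N IHN].
  - simpl. rewrite Phi_at_0. ring.
  - change (Csum ?U (S (S N))) with (Csum U (S N) + U (S N))%C. cbv beta.
    rewrite IHN, Phi_at_0. ring.
Qed.

(** With [S N] summands the operator in the remainder has order [S N] while [Phi] has index [N];
    this offset decides the parity used when the lemma is applied. *)
Lemma expansion_remainder (lam : nat -> R) (fd : nat -> R -> R) (x0 gamma x : R) (N : nat) (B : R) :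
  smooth_seq_on x0 (x0 + gamma) fd -> x0 <= x <= x0 + gamma ->
  (forall t, x0 <= t <= x ->
    Rabs (Dn lam (S N) fd t) * Cmod (Phi lam N (Complex.RtoC (x - t))) <= B) ->
  Cmod (psum lam fd x0 (S N) (Complex.RtoC x) - Complex.RtoC (fd O x))%C <= B * (x - x0).
Proof.
  intros Hs Hx HB.
  destruct (Dn_extension lam x0 (x0 + gamma) fd Hs) as [g Hg].
  assert (Harg : forall t : R, (x + t * (- (1)))%C = Complex.RtoC (x - t))
    by (intros; rewrite RtoC_minus; ring).
  assert (E0 : psum lam fd x0 (S N) (Complex.RtoC x) =
    Csum (fun n => g n x0 * Phi lam n (x + x0 * (- (1))))%C (S N)).
  { rewrite psum_Csum. apply Csum_ext. intros n. rewrite term_scal.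
    rewrite (proj1 (Hg n x0 ltac:(lra))), Harg, RtoC_minus. reflexivity. }
  assert (E1 : Complex.RtoC (fd O x) =
    Csum (fun n => g n x * Phi lam n (x + x * (- (1))))%C (S N)).
  { rewrite Harg. replace (x - x) with 0 by ring.
    rewrite (Csum_at_base_point lam (fun n => g n x)). now rewrite (proj1 (Hg O x Hx)). }
  rewrite E0, E1, Cmod_sub_comm.
  replace (B * (x - x0)) with (B * x - B * x0) by ring.
  apply (curve_mean_value
    (fun s => Csum (fun n => g n s * Phi lam n (x + s * (- (1))))%C (S N))
    (fun s => Dn lam (S N) fd s * Phi_prev lam (S N) (x + s * (- (1))))%C
    (fun s => B * s) (fun _ => B)); [lra| | |].
  - intros s Hsx. apply expansion_base_point_deriv. intros n. apply Hg. lra.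
  - intros s _. auto_derive; auto; ring.
  - intros s Hsx. rewrite Harg, Cmod_mult, Cmod_R. now apply HB.
Qed.

Theorem mainTheorem10
  (lam : nat -> R) (beta : R) (hbeta : 0 < beta)
  (hlimsup : forall eps, 0 < eps -> exists N : nat, forall n : nat,
      (N <= n)%nat -> Rabs (lam n) / INR n <= beta + eps)
  (x0 gamma : R) (hgamma : 0 < gamma)
  (f : R -> R) (fd : nat -> R -> R)
  (hf0 : forall t, x0 <= t <= x0 + gamma -> fd O t = f t)
  (hsmooth : smooth_seq_on x0 (x0 + gamma) fd)
  (Cst sigma : R) (hC : 0 < Cst) (hsigma : 0 < sigma)
  (hbound : forall (n : nat) t, x0 <= t <= x0 + gamma ->
      Rabs (Dn lam (2 * n) fd t) <= Cst * INR (fact (2 * n)) * sigma ^ (2 * n)) :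
  let rho := ln (1 + beta / sigma) / beta in
  exists F : Cplx -> Cplx,
    (* absolute and uniform convergence on compact subsets of the disc *)
    (forall r, 0 < r < rho ->
       (forall eps, 0 < eps -> exists N0 : nat, forall N : nat, (N0 <= N)%nat ->
          forall z : Cplx, Cnorm (Csub z (RtoC x0)) <= r ->
            Cnorm (Csub (psum lam fd x0 N z) (F z)) < eps) /\
       (forall eps, 0 < eps -> exists N0 : nat, forall N M : nat, (N0 <= N)%nat ->
          forall z : Cplx, Cnorm (Csub z (RtoC x0)) <= r ->
            abs_block lam fd x0 N M z < eps)) /\
    (* F is analytic on the open disc *)
    (forall z : Cplx, Cnorm (Csub z (RtoC x0)) < rho -> C_differentiable F z) /\
    (* F extends f near x0 *)
    (exists delta, 0 < delta /\ delta <= gamma /\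
       forall x, x0 <= x <= x0 + delta -> F (RtoC x) = RtoC (f x)).
Proof.
  intros rho.
  set (S0 := fun y : C => CSeries (fun n => Dn lam n fd x0 * Phi lam n y)%C).
  assert (Hrho : 0 < rho).
  { unfold rho. apply Rdiv_lt_0_compat; auto. rewrite <- ln_1. apply ln_increasing; [lra|].
    pose proof (Rdiv_lt_0_compat _ _ hbeta hsigma). lra. }
  (* Any rate above [beta] serves here: it affects only the constant [C'], not [sigma], so the
     coefficient bound is fixed before [r] is chosen. *)
  destruct (linear_growth_of_limsup lam beta (beta + 1) ltac:(lra) hlimsup) as [A1 [HA1 Hlam1]].
  destruct (Dn_bound_at_left lam A1 (beta + 1) x0 gamma Cst sigma fd HA1 ltac:(lra) Hlam1
    hgamma hsmooth hC hsigma hbound) as [C' [HC' HD]].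
  (* One majorant for the terms and their derivatives on each smaller disc; the sharp rate [b], and
     with it [K] and [q], depends on [r]. *)
  assert (Dom : forall r, 0 < r < rho -> exists K q, 0 < K /\ 0 < q < 1 /\
    ex_series (fun n => C' * K * (INR (S n) * q ^ n)) /\
    forall n z, Cmod z <= r ->
      INR (fact n) * sigma ^ n * Cmod (Phi lam n z) <= K * q ^ n /\
      Cmod (Dn lam n fd x0 * Phi lam n z)%C <= C' * K * (INR (S n) * q ^ n) /\
      Cmod (Dn lam n fd x0 * Phi' lam n z)%C <= C' * K * (INR (S n) * q ^ n)).
  { intros r Hr.
    destruct (exists_growth_rate beta sigma r hbeta hsigma (proj2 Hr)) as [b [Hb Hq]].
    destruct (linear_growth_of_limsup lam beta b Hb hlimsup) as [A [HA Hlam]].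
    destruct (Phi_factorial_bounds lam A b sigma r HA ltac:(lra) Hlam hsigma (proj1 Hr) Hq)
      as [K [q [HK [Hq01 P]]]].
    exists K, q. do 2 (split; [auto|]). split.
    { apply (ex_series_scal (V:=R_NormedModule) (C' * K)). now apply ex_series_arith_geom. }
    intros n z Hz. destruct (P n z Hz) as [P1 P2]. split; [exact P1|].
    specialize (HD n). rewrite !Cmod_mult, !Cmod_R.
    set (W := INR (fact n) * sigma ^ n) in *.
    assert (HW : 0 < W) by (apply Rmult_lt_0_compat; [apply INR_fact_lt_0|now apply pow_lt]).
    assert (Q : forall p, 0 <= p -> W * p <= K * (INR (S n) * q ^ n) ->
      Rabs (Dn lam n fd x0) * p <= C' * K * (INR (S n) * q ^ n)).
    { intros p Hp Hpq. apply Rle_trans with (C' * W * p); [now apply Rmult_le_compat_r|].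
      rewrite !Rmult_assoc. rewrite <- !Rmult_assoc in Hpq.
      apply Rmult_le_compat_l; [lra|]. lra. }
    split; apply Q; auto using Cmod_ge_0.
    eapply Rle_trans; [exact P1|]. apply Rmult_le_compat_l; [lra|].
    rewrite S_INR. pose proof (pos_INR n). pose proof (pow_lt q n (proj1 Hq01)). nra. }
  assert (Mpos : forall K q, 0 < K -> 0 < q -> forall n, 0 <= C' * K * (INR (S n) * q ^ n)).
  { intros K q HK Hq n. apply Rmult_le_pos; [nra|].
    apply Rmult_le_pos; [apply pos_INR|apply pow_le; lra]. }
  assert (Conv : forall r, 0 < r < rho ->
    forall eps, 0 < eps -> exists N0 : nat, forall N : nat, (N0 <= N)%nat ->
    forall z : C, Cmod (z - x0)%C <= r -> Cmod (psum lam fd x0 N z - S0 (z - x0))%C < eps).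
  { intros r Hr eps He. destruct (Dom r Hr) as [K [q [HK [Hq [HM P]]]]].
    destruct (tail_small _ (eps / 2) (Mpos K q HK (proj1 Hq)) HM) as [N0 HN0]; [lra|].
    exists N0. intros N HN z Hz. specialize (HN0 N HN).
    rewrite psum_Csum.
    rewrite (Csum_ext _ _ N (fun n => term_scal lam fd x0 n z)).
    eapply Rle_lt_trans; [apply Csum_sub_CSeries_le; [|exact HM]|lra].
    intros n. now apply P. }
  exists (fun z => S0 (z - x0)%C). split; [|split].
  - intros r Hr. split; intros eps He.
    + destruct (Conv r Hr eps He) as [N0 HN0]. exists N0. intros N HN z Hz.
      rewrite Cnorm_Cmod in *. now apply HN0.
    + destruct (Dom r Hr) as [K [q [HK [Hq [HM P]]]]].
      destruct (tail_small _ eps (Mpos K q HK (proj1 Hq)) HM He) as [N0 HN0].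
      exists N0. intros N M HN z Hz. rewrite Cnorm_Cmod in Hz.
      eapply Rle_lt_trans; [apply abs_block_le_tail; [exact HM|now apply Mpos|]|now apply HN0].
      intros n. rewrite term_scal. now apply P.
  - intros z Hz. rewrite Cnorm_Cmod in Hz. change (Cmod (z - x0)%C < rho) in Hz.
    set (y := (z - x0)%C) in *. pose proof (Cmod_ge_0 y).
    (* The midpoint puts [y] strictly inside a disc that is still smaller than the full one. *)
    set (r := (Cmod y + rho) / 2).
    destruct (Dom r ltac:(unfold r; lra)) as [K [q [HK [Hq [HM P]]]]].
    assert (D : complex_deriv S0 y (CSeries (fun n => Dn lam n fd x0 * Phi' lam n y)%C)).
    { apply (CSeries_deriv (fun n y => Dn lam n fd x0 * Phi lam n y)%C
        (fun n y => Dn lam n fd x0 * Phi' lam n y)%C (fun n => C' * K * (INR (S n) * q ^ n)) r y); [unfold r; lra| | | |exact HM].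
      - intros n w _. apply (complex_deriv_ext (fun w => 0 + Dn lam n fd x0 * Phi lam n w)%C);
          [intros; ring|].
        replace (Dn lam n fd x0 * Phi' lam n w)%C with (0 + Dn lam n fd x0 * Phi' lam n w)%C by ring.
        apply (complex_deriv_lin (fun _ => Complex.RtoC 0)); [|apply Phi_deriv].
        intros eps He. exists 1. split; [lra|]. intros h _.
        replace (_ - _ - _)%C with (Complex.RtoC 0) by ring. rewrite Cmod_0.
        pose proof (Cmod_ge_0 h). nra.
      - intros n w Hw. now apply P.
      - intros n w Hw. now apply P. }
    eexists. intros eps He. destruct (D eps He) as [d [Hd H']].
    exists d. split; [exact Hd|]. intros h Hh. rewrite Cnorm_Cmod in *.
    rewrite Cnorm_Cmod. specialize (H' h Hh).
    change (Cadd z h) with (z + h)%C.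
    replace (z + h - x0)%C with (y + h)%C by (unfold y; ring). exact H'.
  - set (r := rho / 2). destruct (Dom r ltac:(unfold r; lra)) as [K [q [HK [Hq [HM P]]]]].
    (* For such [x] all base points stay in the interval of the hypothesis and all arguments [x - t]
       in the disc of radius [r]. *)
    exists (Rmin gamma r). split; [apply Rmin_pos; unfold r; lra|]. split; [apply Rmin_l|].
    intros x Hx. pose proof (Rmin_l gamma r). pose proof (Rmin_r gamma r).
    rewrite <- (hf0 x) by lra.
    (* [S (2m+1) = 2 (m+1)] is even, so [hbound] controls the operator in the remainder at every
       [t]. *)
    assert (Rem : forall m, Cmod (psum lam fd x0 (S (2 * m + 1)) (Complex.RtoC x)
      - Complex.RtoC (fd O x))%C
      <= Cst * sigma * K * r * (INR (S (2 * m + 1)) * q ^ (2 * m + 1))).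
    { intros m. set (n := (2 * m + 1)%nat).
      assert (0 <= INR (S n) * q ^ n)
        by (apply Rmult_le_pos; [apply pos_INR|apply pow_le; lra]).
      assert (0 <= Cst * sigma * K) by (repeat apply Rmult_le_pos; lra).
      apply Rle_trans with ((Cst * sigma * K * (INR (S n) * q ^ n)) * (x - x0)).
      - apply expansion_remainder with gamma; auto; [lra|]. intros t Ht.
        assert (Hxt : Cmod (Complex.RtoC (x - t)) <= r)
          by (rewrite Cmod_R, Rabs_pos_eq; lra).
        destruct (P n _ Hxt) as [P1 _].
        pose proof (hbound (m + 1)%nat t ltac:(lra)) as HB.
        replace (2 * (m + 1))%nat with (S n) in HB by (unfold n; lia).
        eapply Rle_trans; [apply Rmult_le_compat_r; [apply Cmod_ge_0|exact HB]|].
        (* [(n+1)!] exceeds the [n!] absorbed by [Phi_n] by a factor [n + 1], which [q^n] still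
           beats. *)
        rewrite fact_simpl, mult_INR. simpl (sigma ^ S n).
        replace (Cst * (INR (S n) * INR (fact n)) * (sigma * sigma ^ n)
            * Cmod (Phi lam n (Complex.RtoC (x - t)))) with
          ((Cst * sigma * INR (S n)) * (INR (fact n) * sigma ^ n
            * Cmod (Phi lam n (Complex.RtoC (x - t))))) by ring.
        replace (Cst * sigma * K * (INR (S n) * q ^ n)) with
          ((Cst * sigma * INR (S n)) * (K * q ^ n)) by ring.
        apply Rmult_le_compat_l; auto. pose proof (pos_INR (S n)).
        repeat apply Rmult_le_pos; lra.
      - replace (Cst * sigma * K * r * (INR (S n) * q ^ n)) with
          ((Cst * sigma * K * (INR (S n) * q ^ n)) * r) by ring.
        apply Rmult_le_compat_l; [now apply Rmult_le_pos|lra]. }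
    assert (Hsmall : forall eps, 0 < eps -> Cmod (S0 (x - x0)%C - Complex.RtoC (fd O x))%C <= eps).
    { intros eps He.
      destruct (Conv r ltac:(unfold r; lra) (eps / 2)) as [N0 HN0]; [lra|].
      assert (Hlim : is_lim_seq (fun n => Cst * sigma * K * r * (INR (S n) * q ^ n)) 0).
      { replace (Finite 0) with (Rbar_mult (Cst * sigma * K * r) 0) by (simpl; f_equal; ring).
        apply is_lim_seq_scal_l. apply ex_series_lim_0. now apply ex_series_arith_geom. }
      apply is_lim_seq_spec in Hlim.
      destruct (Hlim (mkposreal (eps / 2) ltac:(lra))) as [N1 HN1].
      (* Large enough both for the partial sum to be near [S0] and for the remainder to be small. *)
      set (m := (N0 + N1)%nat).
      specialize (HN0 (S (2 * m + 1)) ltac:(unfold m; lia) (Complex.RtoC x)).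
      specialize (HN1 (2 * m + 1)%nat ltac:(unfold m; lia)). cbv beta in HN1. simpl pos in HN1.
      specialize (Rem m).
      assert (Hxr : Cmod (x - x0)%C <= r)
        by (rewrite <- RtoC_minus, Cmod_R, Rabs_pos_eq; lra).
      specialize (HN0 Hxr). rewrite Rminus_0_r in HN1.
      apply Rle_lt_trans with (1 := Rle_abs _) in HN1.
      set (p := psum lam fd x0 (S (2 * m + 1)) (Complex.RtoC x)) in *.
      replace (S0 (x - x0) - Complex.RtoC (fd O x))%C with
        ((S0 (x - x0)%C - p) + (p - Complex.RtoC (fd O x)))%C by ring.
      eapply Rle_trans; [apply Cmod_triangle|]. rewrite (Cmod_sub_comm (S0 _)). lra. }
    assert (EZ : (S0 (x - x0) - Complex.RtoC (fd O x))%C = Complex.RtoC 0).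
    { apply Cmod_eq_0, Rle_antisym; [|apply Cmod_ge_0].
      apply Rnot_lt_le. intros Hlt. specialize (Hsmall _ (Rdiv_lt_0_compat _ 2 Hlt ltac:(lra))). lra. }
    change (S0 (x - x0)%C = Complex.RtoC (fd O x)).
    replace (S0 (x - x0)%C) with ((S0 (x - x0) - Complex.RtoC (fd O x)) + Complex.RtoC (fd O x))%C by ring.
    rewrite EZ. ring.
Qed.
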